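(* Let $N\ge1$, let $\mathcal V$ be the algebra of difference polynomials in the variables $u_i$, $i\in\mathbb Z_{\le N-1}$, and let $L(S)=S^N+\sum_{i\le N-1}u_iS^i\in\mathcal V((S^{-1}))$ be the pseudodifference operator of generic type of order $N$. Then $L(S)$ defines a (rational, in general non-local) multiplicative Poisson vertex algebra structure on $\mathcal V$ via the following Dirac reduced 2-Adler type identity: $$\{L(z)_\lambda L(w)\}_2^{(L)D}=L(w\lambda S)\,\delta_+\Big(\frac{w\lambda S}z\Big)L^*(z^{-1}\lambda)-L(z)\,\delta_+\Big(\frac{w\lambda S}z\Big)L(w)+\big(L(w)(\lambda S)^N-L(w\lambda S)\big)\big((\lambda S)^N-1\big)^{-1}\big(L(z)-L^*(z^{-1}\lambda)\big).$$ That is, letting $\{{u_i}_\lambda u_j\}$, $i,j\le N-1$, be the coefficient of $z^iw^j$ of the right-hand side and extending to $\mathcal V$ by sesquilinearity and the Leibniz rules gives a multiplicative Poisson vertex algebra structure for which this identity holds.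
   Context: The base field $\mathbb F$ has characteristic $0$. The algebra of difference polynomials in variables $u_i$ is the polynomial algebra in independent variables $S^k(u_i)$, $k\in\mathbb Z$, with shift automorphism $S$. A non-local multiplicative Poisson vertex algebra (mPVA) structure on a unital commutative associative algebra $\mathcal V$ with automorphism $S$ is a linear map $\mathcal V\otimes\mathcal V\to\mathcal V[[\lambda,\lambda^{-1}]]$ (bilateral series), $a\otimes b\mapsto\{a_\lambda b\}$, with: $\{S(a)_\lambda b\}=\lambda^{-1}\{a_\lambda b\}$, $\{a_\lambda S(b)\}=\lambda S\{a_\lambda b\}$; $\{a_\lambda bc\}=\{a_\lambda b\}c+\{a_\lambda c\}b$; $\{ab_\lambda c\}=\sum_n(p_nS^n(b)+q_nS^n(a))\lambda^n$ where $\{a_\lambda c\}=\sum_np_n\lambda^n$, $\{b_\lambda c\}=\sum_nq_n\lambda^n$; $\{b_\lambda a\}=-\sum_nS^{-n}(c_n)\lambda^{-n}$ if $\{a_\lambda b\}=\sum_nc_n\lambda^n$; $\{a_\lambda\{b_\mu c\}\}-\{b_\mu\{a_\lambda c\}\}=\{\{a_\lambda b\}_{\lambda\mu}c\}$. It is rational if each $\{a_\lambda b\}$ is the symbol of a rational difference operator $r(S)$ (over the fraction field of $\mathcal V$), i.e. $\frac12(r^++r^-)$ where $r^\pm(\lambda)$ is obtained by expanding $r(S)$ as a Laurent series in $S^{\pm1}$ with coefficients on the left and replacing $S$ by $\lambda$. $\mathcal V((S^{-1}))$ has coefficients on the left and product determined by $S\circ f=S(f)S$. With $u_N=1$ and $L(S)=\sum_{n\le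 N}u_nS^n$: $L(z)=\sum_nu_nz^n$, $L(w\lambda S)=\sum_nu_nw^n\lambda^nS^n$, $L^*(z^{-1}\lambda)=\sum_nS^{-n}(u_n)\lambda^{-n}z^n$, $\delta_+(w\lambda S/z)=\sum_{k\ge0}w^k\lambda^kz^{-k}S^k$. Each $S$ acts on all coefficients written to its right. $((\lambda S)^N-1)^{-1}$ stands for half the sum of its two geometric expansions, $\frac12\big(-\sum_{k\ge0}(\lambda S)^{kN}+\sum_{k\ge1}(\lambda S)^{-kN}\big)$. The left-hand side is $\sum_{i,j\le N}\{{u_i}_\lambda u_j\}z^iw^j$ (with zero bracket for the constant $u_N=1$). *)

(* Defs.v *)
From HB Require Import structures.
From mathcomp Require Import all_boot all_order all_algebra finmap.
From mathcomp Require Import boolp classical_sets fsbigop.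
From mathcomp Require Import monalg.
From mathcomp Require mpoly.
Import (canonicals) mpoly.

Set Implicit Arguments.
Unset Strict Implicit.
Unset Printing Implicit Defensive.

Import Order.TTheory GRing.Theory Num.Theory.

Local Open Scope ring_scope.

Section PolyDomain.
Variables (F : fieldType) (I : choiceType).
Local Notation P := {malg F[{cmonom I}]}.

(* The ring morphism to {mpoly F[size s]} keeping only the variables in [s];
   it is injective on the polynomials involving no other variables. *)
Section Restrict.
Variable s : seq I.

Definition restr_cmonom (m : {cmonom I}) : mpoly.multinom (size s) :=
  mpoly.Multinom [tuple m (tnth (in_tuple s) k) | k < size s].

Definition restr_monom (m : {cmonom I}) : mpoly.mpoly (size s) F :=
  mpoly.mpolyX F (restr_cmonom m).

Lemma restr_monomM : mmorphism restr_monom.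
Proof.
split=> [m1 m2|]; rewrite /restr_monom.
  rewrite -mpoly.mpolyXD; congr mpoly.mpolyX; apply/mpoly.mnmP => k.
  by rewrite mpoly.mnmDE !mpoly.multinomE !tnth_mktuple cmM.
rewrite -mpoly.mpolyX0; congr mpoly.mpolyX; apply/mpoly.mnmP => k.
by rewrite mpoly.mnm0E mpoly.multinomE tnth_mktuple cm1.
Qed.

HB.instance Definition _ := isMultiplicative.Build _ _ restr_monom restr_monomM.

Lemma restr_poly_eq0 (p : P) :
    (forall m i, m \in msupp p -> i \in finsupp m -> i \in s) ->
  mmap (@mpoly.mpolyC (size s) F) restr_monom p = 0 -> p = 0.
Proof.
move=> ps p0; apply/malgP => m0; rewrite mcoeff0.
have [m0p|/mcoeff_outdom //] := boolP (m0 \in msupp p).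
have c_inj m : m \in msupp p -> restr_cmonom m = restr_cmonom m0 -> m = m0.
  move=> mp /mpoly.mnmP cE; apply/eqP/cmP => i.
  have [/seq_tnthP[k ->]|] := boolP (i \in s).
    by have := cE k; rewrite !mpoly.multinomE !tnth_mktuple => mk; exact: mk.
  by move=> iNs; rewrite !fsfun_dflt //; apply: contra iNs; apply: ps.
have := congr1 (mpoly.mcoeff (restr_cmonom m0)) p0.
rewrite mpoly.mcoeff0 mmapE raddf_sum /= (big_fsetD1 m0) //=.
rewrite mpoly.mcoeffCM mpoly.mcoeffX eqxx mulr1 big_seq big1 ?addr0 // => m.
rewrite in_fsetD1 => /andP[mNm0 mp].
rewrite mpoly.mcoeffCM mpoly.mcoeffX.
by case: eqP => [/(c_inj _ mp)/eqP|]; rewrite ?(negPf mNm0) ?mulr0.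
Qed.

End Restrict.

Lemma malg_integral (p q : P) : p * q = 0 -> (p == 0) || (q == 0).
Proof.
move=> pq0.
pose vars (r : P) := flatten [seq (finsupp (m : {cmonom I}) : seq I) | m <- msupp r].
have varsP (r : P) (m : {cmonom I}) i : m \in msupp r -> i \in finsupp m -> i \in vars r.
  by move=> mr im; apply/flatten_mapP; exists m.
pose s := vars p ++ vars q.
have := congr1 (mmap (@mpoly.mpolyC (size s) F) (restr_monom s)) pq0.
rewrite rmorphM mmap0 => /mpoly.mpoly_idomainAxiom.
by case/orP => /eqP /restr_poly_eq0 -> //; rewrite ?eqxx ?orbT // => m i mp im;
  rewrite mem_cat (varsP _ _ _ mp im) ?orbT.
Qed.

Definition malg_unit : {pred P} := fun p => `[< exists q, q * p = 1 >].
Definition malg_inv (p : P) : P := xget p [set q | q * p = 1]%classic.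

Lemma malg_mulVx : {in malg_unit, left_inverse 1 malg_inv *%R}.
Proof. by move=> p /asboolP; apply: (xgetPex p). Qed.

Lemma malg_unitPl (p q : P) : q * p = 1 -> malg_unit p.
Proof. by move=> qp; apply/asboolP; exists q. Qed.

Lemma malg_inv_out : {in [predC malg_unit], malg_inv =1 id}.
Proof.
move=> p pNU; rewrite /malg_inv; case: xgetP => // q _ qp.
by case/negP: pNU; apply: malg_unitPl qp.
Qed.

HB.instance Definition _ :=
  GRing.ComNzRing_hasMulInverse.Build P malg_mulVx malg_unitPl malg_inv_out.
HB.instance Definition _ :=
  GRing.ComUnitRing_isIntegral.Build P malg_integral.

End PolyDomain.

HB.lock Definition pvar (F : fieldType) (I : choiceType) (i : I) :
  {malg F[{cmonom I}]} := << ucm i >>.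

Section Variables.
Variables (F : fieldType) (I : choiceType).
Local Notation P := {malg F[{cmonom I}]}.

Local Notation pvar := (@pvar F I).

Definition monom_subst (f : I -> P) (m : {cmonom I}) : P :=
  \prod_(i <- finsupp m) f i ^+ m i.

Definition poly_subst (f : I -> P) : P -> P :=
  mmap (@malgC {cmonom I} F) (monom_subst f).

Lemma monom_substEw f (m : {cmonom I}) (d : {fset I}) :
  (finsupp m `<=` d)%fset -> monom_subst f m = \prod_(i <- d) f i ^+ m i.
Proof.
move=> md; rewrite /monom_subst (big_fset_incl _ md) //= => i _ im.
by rewrite fsfun_dflt.
Qed.

Lemma monom_substM f : mmorphism (monom_subst f).
Proof.
split=> [m1 m2|]; last by rewrite /monom_subst mdom1 big_seq_fset0.
rewrite (monom_substEw f (fsubsetUl (finsupp m1) (finsupp m2))).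
rewrite (monom_substEw f (fsubsetUr (finsupp m1) (finsupp m2))).
rewrite /monom_subst mdomD -big_split /=.
by apply: eq_bigr => i _; rewrite cmM exprD.
Qed.

HB.instance Definition _ f :=
  isMultiplicative.Build _ _ (monom_subst f) (monom_substM f).
HB.instance Definition _ f := GRing.RMorphism.on (poly_subst f).

Lemma poly_substZ f : scalable (poly_subst f).
Proof. by move=> a p; rewrite /poly_subst mmapZ mul_malgC. Qed.

HB.instance Definition _ f :=
  GRing.isScalable.Build F P P *:%R (poly_subst f) (poly_substZ f).

Lemma poly_subst_var f i : poly_subst f (pvar i) = f i.
Proof.
rewrite pvar.unlock /poly_subst mmapU mul_malgC scale1r /monom_subst mdomU.
by rewrite big_seq_fset1 cmUU.
Qed.

Lemma malgUM (m1 m2 : {cmonom I}) : << mmul m1 m2 >> = << m1 >> * << m2 >> :> P.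
Proof. by rewrite malgM_def fgmulUU mulr1. Qed.

Lemma monom_ext (f g : {rmorphism P -> P}) (m : {cmonom I}) :
  (forall i, f (pvar i) = g (pvar i)) -> f << m >> = g << m >>.
Proof.
move=> fg; have [n] := ubnP (mdeg m); elim: n m => // n IHn m mn.
have [->|/eqP mN1] := eqVneq m mone; first by rewrite !rmorph1.
have [i im] : exists i, i \in finsupp m.
  have [m0|//] := fset_0Vmem (finsupp m); last by case=> i; exists i.
  by case: mN1; apply/eqP/cmP => i; rewrite cm1 fsfun_dflt ?m0.
have mE : m = mmul (ucm i) (divcm m (ucm i)).
  apply/eqP/cmP => j; rewrite cmM divcmE cmU.
  case: eqVneq => [<-|_]; last by rewrite subn0.
  by rewrite subnKC // lt0n cmE_neq0.
have hm (h : {rmorphism P -> P}) :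
    h << m >> = h (pvar i) * h << divcm m (ucm i) >>.
  by rewrite {1}mE malgUM pvar.unlock; apply: rmorphM.
rewrite (hm f) (hm g) (fg i) (IHn (divcm m (ucm i))) //.
by move: mn; rewrite {1}mE mdegM mdegU.
Qed.

Lemma poly_ext (f g : {lrmorphism P -> P}) :
  (forall i, f (pvar i) = g (pvar i)) -> f =1 g.
Proof.
move=> fg p; rewrite (monalgE p) !raddf_sum; apply: eq_bigr => m _ /=.
have -> : << p@_m *g m >> = p@_m *: << m >> :> P.
  by rewrite -mul_malgC malgM_def fgmulUU mulr1 mul1m.
by rewrite !linearZ /= (monom_ext m fg).
Qed.

End Variables.

(* [autz S S' n] is the [n]-th power of the automorphism [S], where [S'] is the
   inverse of [S]. *)
Definition autz (A : Type) (S S' : A -> A) (n : int) : A -> A :=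
  match n with Posz k => iter k S | Negz k => iter k.+1 S' end.

Section MPVA.
Variables (F : fieldType) (V : comAlgType F) (S S' : V -> V).
Local Notation "S ^^ n" := (autz S S' n) (at level 30).

(* A bilateral series sum_n c_n lambda^n is the function n |-> c_n. *)
Implicit Type br : V -> V -> int -> V.

Record is_lambda_bracket br : Prop := {
  bracket_linearl : forall (k : F) a a' b n,
    br (k *: a + a') b n = k *: br a b n + br a' b n;
  bracket_linearr : forall (k : F) a b b' n,
    br a (k *: b + b') n = k *: br a b n + br a b' n;
  bracket_sesquil : forall a b n, br (S a) b n = br a b (n + 1);
  bracket_sesquir : forall a b n, br a (S b) n = S (br a b (n - 1));
  bracket_leibnizr : forall a b c n,
    br a (b * c) n = br a b n * c + br a c n * b;
  bracket_leibnizl : forall a b c n,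
    br (a * b) c n = br a c n * (S ^^ n) b + br b c n * (S ^^ n) a
}.

Definition bracket_skew br : Prop :=
  forall a b n, br b a n = - (S ^^ n) (br a b (- n)).

(* The coefficients of lambda^m mu^n in the Jacobi identity; in
   {{a_lambda b}_(lambda mu) c} the inner bracket contributes lambda^(m - n)
   and the outer one (lambda mu)^n. *)
Definition bracket_jacobi br : Prop :=
  forall a b c m n,
    br a (br b c n) m - br b (br a c m) n = br (br a b (m - n)) c n.

Record is_mPVA br : Prop := {
  mPVA_bracket : is_lambda_bracket br;
  mPVA_skew : bracket_skew br;
  mPVA_jacobi : bracket_jacobi br
}.

End MPVA.

Section OperatorSeries.
Variables (A : pzRingType) (S S' : A -> A).

(* Series sum_e X_e t^e with coefficients on the left and exponents in a group
   [E]; the monomials t^e multiply by t^d t^e = t^(d + e), and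
   t^e a = S^(deg e)(a) t^e for a in A.  For E = int and deg = id these are the series
   in S.  Each coefficient of a product is a sum over [E], which has to have
   finite support (otherwise the sum is 0 by convention). *)
Definition opmul (E : zmodType) (deg : E -> int) (X Y : E -> A) : E -> A :=
  fun e => \sum_(d \in [set: E]%classic) X d * autz S S' (deg d) (Y (e - d)).

Definition bounded_above (X : int -> A) : Prop :=
  exists M : int, forall n, M < n -> X n = 0.

Definition bounded_below (X : int -> A) : Prop :=
  exists M : int, forall n, n < M -> X n = 0.

(* The elements of A[S, S^-1]. *)
Definition is_diffop (X : int -> A) : Prop :=
  bounded_above X /\ bounded_below X.

End OperatorSeries.

Section Rational.
Variable V : idomainType.
Local Notation K := {fraction V}.
Local Notation "x %:F" := (@FracField.tofrac V x).

(* The extension to the fraction field of an injective ring endomorphism. *)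
Definition frac_lift (f : V -> V) (x : K) : K :=
  (f \n_(repr x))%:F / (f \d_(repr x))%:F.

Lemma fracE (x : K) : x = (\n_(repr x))%:F / (\d_(repr x))%:F.
Proof.
have d0 := denom_ratioP (repr x).
apply: (mulIf (x := (\d_(repr x))%:F)); first by rewrite tofrac_eq0.
rewrite divfK ?tofrac_eq0 // -{1}[x]reprK.
rewrite [LHS](_ : _ = FracField.mul (\pi_K%qT (repr x)) (\d_(repr x))%:F) //.
rewrite !piE; apply/eqP.
rewrite -[_ == _]/(_ == _ %[mod K])%qT FracField.equivf_def.
by rewrite /FracField.mulf !numden_Ratio ?mulf_neq0 ?oner_eq0 // !mulr1 mulrC.
Qed.

Lemma frac_liftE (f : {rmorphism V -> V}) (a b : V) :
  injective f -> b != 0 -> frac_lift f (a%:F / b%:F) = (f a)%:F / (f b)%:F.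
Proof.
move=> f_inj b0; rewrite /frac_lift; set x := a%:F / b%:F.
have d0 := denom_ratioP (repr x); set n := \n_(repr x); set d := \d_(repr x).
have fN0 c : c != 0 -> (f c)%:F != 0 :> K.
  by move=> c0; rewrite tofrac_eq0 -(rmorph0 f) (inj_eq f_inj).
apply/eqP; rewrite eqr_div ?fN0 // -!tofracM tofrac_eq -!rmorphM (inj_eq f_inj).
rewrite -tofrac_eq !tofracM -eqr_div ?tofrac_eq0 //.
by rewrite -fracE.
Qed.

Variables S S' : V -> V.
Local Notation opmulK := (opmul (frac_lift S) (frac_lift S') (@id int)).

(* The rational operator is r = A B^-1, and r^+ in K((S)), r^- in K((S^-1))
   are its two expansions, that is r^+ B = A and r^- B = A. *)
Definition is_rational_symbol (c : int -> V) : Prop :=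
  exists (A B rp rm : int -> K),
    [/\ is_diffop A /\ is_diffop B,
        exists n, B n != 0,
        bounded_below rp /\ opmulK rp B = A,
        bounded_above rm /\ opmulK rm B = A &
        forall n, (c n)%:F = (rp n + rm n) / 2%:R].

Definition is_rational_bracket (br : V -> V -> int -> V) : Prop :=
  forall a b, is_rational_symbol (br a b).

End Rational.

Section DifferencePolynomials.
Variables (F : fieldType) (N : nat).

(* The pair (i, k) stands for the variable S^k(u_i). *)
Definition dvar : choiceType := ({i : int | i < N%:Z} * int)%type.
Definition dvar_shift (k : int) (x : dvar) : dvar := (x.1, x.2 + k).

Local Notation V := {malg F[{cmonom dvar}]}.

Definition shift (k : int) : V -> V :=
  poly_subst (fun x => pvar F (dvar_shift k x)).

HB.instance Definition _ k := GRing.LRMorphism.on (shift k).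

Lemma shift_var k x : shift k (pvar F x) = pvar F (dvar_shift k x).
Proof. exact: poly_subst_var. Qed.

Lemma shiftK k : cancel (shift k) (shift (- k)).
Proof.
move=> p; pose g : {lrmorphism V -> V} := shift (- k) \o shift k.
apply: (@poly_ext F dvar g idfun _ p) => -[i n].
rewrite /= (shift_var k) (shift_var (- k)).
by rewrite /dvar_shift /= addrK.
Qed.

(* The coefficients of S^N + sum_(i <= N - 1) u_i S^i. *)
Definition genericL (n : int) : V :=
  if insub n is Some i then pvar F ((i, 0) : dvar)
  else if n == N%:Z then 1 else 0.

End DifferencePolynomials.

Notation diffpoly F N := {malg F[{cmonom dvar N}]}.

Section Adler.
Variables (F : fieldType) (V : comAlgType F) (S S' : V -> V).

(* The coefficient of z^i w^j lambda^l S^s sits at (i, j, l, s). *)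
Local Notation expo := (int * int * int * int)%type.

Definition expoS (e : expo) : int := e.2.

Local Notation "X *o Y" := (opmul S S' expoS X Y) (at level 40).

Variables (N : nat) (L : int -> V).

Definition L_z : expo -> V := fun '(i, j, l, s) =>
  if [&& j == 0, l == 0 & s == 0] then L i else 0.

Definition L_w : expo -> V := fun '(i, j, l, s) =>
  if [&& i == 0, l == 0 & s == 0] then L j else 0.

Definition L_wlS : expo -> V := fun '(i, j, l, s) =>
  if [&& i == 0, l == j & s == j] then L j else 0.

(* L^*(z^-1 lambda) *)
Definition Ladj_zl : expo -> V := fun '(i, j, l, s) =>
  if [&& j == 0, l == - i & s == 0] then autz S S' (- i) (L i) else 0.

(* delta_+(w lambda S / z) *)
Definition delta_plus : expo -> V := fun '(i, j, l, s) =>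
  if [&& 0 <= j, i == - j, l == j & s == j] then 1 else 0.

Definition lS_pow (n : int) : expo -> V := fun '(i, j, l, s) =>
  if [&& i == 0, j == 0, l == n & s == n] then 1 else 0.

(* ((lambda S)^N - 1)^-1 *)
Definition lS_geom : expo -> V := fun '(i, j, l, s) =>
  if [&& i == 0, j == 0, l == s & (N%:Z %| s)%Z]
  then (2%:R^-1 : F) *: (if 0 <= s then -1 else 1) else 0.

Definition adlerD_op : expo -> V :=
  (L_wlS *o delta_plus *o Ladj_zl)
  \- (L_z *o delta_plus *o L_w)
  \+ ((L_w *o lS_pow N \- L_wlS) *o lS_geom *o (L_z \- Ladj_zl)).

(* The coefficient of z^i w^j lambda^n, S acting on the coefficients to its
   right and fixing 1. *)
Definition adlerD (i j n : int) : V :=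
  \sum_(s \in [set: int]%classic) adlerD_op (i, j, n, s).

End Adler.

(* Main.v *)
Require Import Defs.
From HB Require Import structures.
From mathcomp Require Import all_boot all_order all_algebra finmap.
From mathcomp Require Import boolp classical_sets fsbigop.
From mathcomp Require Import monalg.
From mathcomp Require Import zify ring.

(* A multiplicative Poisson vertex algebra structure is the same thing as a
   shift-invariant Poisson bracket P, via {a_lambda b} = sum_n P(S^n a, b)
   lambda^n.  Writing l_(a, b) = S^a(u_(b - a)) for the entries of the
   bi-infinite matrix of L, with l_(a, a + N) = 1, the Adler type identity
   becomes
     2 P(l_(a, b), l_(c, d)) = (sgn(c - a) + sgn(d - b)) l_(a, d) l_(c, b)
                               + E l_(a, b) l_(c, d),
   where E is a sum of functions of c - a, d - b, d - a and b - c: the Sklyanin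
   bracket modified by a log-canonical term, which is chosen so that the entries
   equal to 1 are central.  The Jacobi identity on entries then reduces to the
   coefficients of the two 3-cycles l_(a1, b2) l_(a2, b3) l_(a3, b1) and
   l_(a1, b3) l_(a2, b1) l_(a3, b2).
   The bracket is rational because its non-local part is a sum of terms
   x (S^N - 1)^-1 h, which have a common right denominator by linear algebra. *)

Set Implicit Arguments.
Unset Strict Implicit.
Unset Printing Implicit Defensive.

Import Order.TTheory GRing.Theory Num.Theory.

Local Open Scope ring_scope.

Lemma mulr_leibniz (R : comPzRingType) (p q a b : R) :
  p * b + a * q = a * q + b * p.
Proof. by rewrite addrC [p * b]mulrC. Qed.

(** * Derivations of polynomial algebras *)

Section PolynomialDerivations.
Variables (F : fieldType) (I : choiceType).
Local Notation P := {malg F[{cmonom I}]}.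
Local Notation x_ i := (pvar F i).

(** Induction on the degree of a monomial, one variable being split off at a time; 0, which the
    empty sum requires, is obtained as $(-1)\cdot 1+1$. *)
Lemma malg_var_ind (Q : P -> Prop) :
    Q 1 -> (forall k p q, Q p -> Q q -> Q (k *: p + q)) ->
    (forall p q, Q p -> Q q -> Q (p * q)) -> (forall i, Q (x_ i)) ->
  forall p, Q p.
Proof.
move=> Q1 QZD QM Qx.
have Q0 : Q 0 by rewrite -(addNr 1) -scaleN1r; apply: QZD.
have Qm n (m : {cmonom I}) q : (mdeg m < n)%N -> q = << m >> -> Q q.
  elim: n m q => [|n IHn] m q; first by rewrite ltn0.
  have [->|/eqP mN1 mn ->] := eqVneq m mone; first by move=> _ ->; exact: Q1.
  have [i im] : exists i, i \in finsupp m.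
    have [m0|] := fset_0Vmem (finsupp m); last by case=> i; exists i.
    by case: mN1; apply/eqP/cmP => i; rewrite cm1 fsfun_dflt ?m0.
  have mE : m = mmul (ucm i) (divcm m (ucm i)).
    apply/eqP/cmP => j; rewrite cmM divcmE cmU.
    case: eqVneq => [<-|_]; last by rewrite subn0.
    by rewrite subnKC // lt0n cmE_neq0.
  have qn : (mdeg (divcm m (ucm i)) < n)%N by move: mn; rewrite {1}mE mdegM mdegU.
  have := QM _ _ (Qx i) (IHn _ _ qn erefl).
  by rewrite pvar.unlock -malgUM -mE.
move=> p; rewrite (monalgE p); elim/big_ind: _; first exact: Q0.
  by move=> q r Qq Qr; rewrite -[q]scale1r; apply: QZD.
move=> m _; have -> : << p@_m *g m >> = p@_m *: << m >> + 0 :> P.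
  by rewrite addr0 -mul_malgC malgM_def fgmulUU mulr1 mul1m.
exact: QZD (Qm _ m _ (ltnSn _) erefl) Q0.
Qed.

Variable f : I -> P.

Definition dual_monom (m : {cmonom I}) : {poly P} :=
  \prod_(i <- finsupp m) ((x_ i)%:P + (f i)%:P * 'X) ^+ m i.

Lemma dual_monomEw (m : {cmonom I}) (d : {fset I}) : (finsupp m `<=` d)%fset ->
  dual_monom m = \prod_(i <- d) ((x_ i)%:P + (f i)%:P * 'X) ^+ m i.
Proof.
move=> md; rewrite /dual_monom (big_fset_incl _ md) //= => i _ im.
by rewrite fsfun_dflt.
Qed.

Lemma dual_monomM : mmorphism dual_monom.
Proof.
split=> [m1 m2|]; last by rewrite /dual_monom mdom1 big_seq_fset0.
rewrite (dual_monomEw (fsubsetUl (finsupp m1) (finsupp m2))).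
rewrite (dual_monomEw (fsubsetUr (finsupp m1) (finsupp m2))).
rewrite /dual_monom mdomD -big_split /=.
by apply: eq_bigr => i _; rewrite cmM exprD.
Qed.

HB.instance Definition _ := isMultiplicative.Build _ _ dual_monom dual_monomM.

(* The substitution [x_ i |-> x_ i + f i * 'X], which modulo ['X^2] is the
   sum of the identity and of the derivation mapping [x_ i] to [f i]. *)
Lemma dual_subst_exists : exists h : P -> {poly P},
  [/\ h 1 = 1, forall i, h (x_ i) = (x_ i)%:P + (f i)%:P * 'X,
      forall k p q, h (k *: p + q) = k%:A%:P * h p + h q
    & forall p q, h (p * q) = h p * h q].
Proof.
exists (mmap (polyC \o @malgC {cmonom I} F) dual_monom); split=> [|i|k p q|p q].
- exact: rmorph1.
- rewrite {1}pvar.unlock mmapU /= mpolyC1E mul1r /dual_monom.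
  by rewrite mdomU big_seq_fset1 cmUU.
- by rewrite mmapD mmapZ /= -mul_malgC mulr1.
- exact: rmorphM.
Qed.

(** The derivation is the coefficient of ['X] in the substitution [h]. The constant coefficient of
    [h p] is [p], so the product in [{poly P}] gives the Leibniz rule. *)
Lemma deriv_exists : exists D : P -> P,
  [/\ forall i, D (x_ i) = f i, forall k p q, D (k *: p + q) = k *: D p + D q
    & forall p q, D (p * q) = D p * q + D q * p].
Proof.
have [h [h1 hx hZD hM]] := dual_subst_exists.
have h0 p : (h p)`_0 = p.
  elim/malg_var_ind: p => [|k p q p0 q0|p q p0 q0|i].
  - by rewrite h1 coefC.
  - by rewrite hZD coefD coefCM p0 q0 mulr_algl.
  - by rewrite hM coefM big_ord1 p0 q0.
  - by rewrite hx coefD coefC coefMX addr0.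
exists (fun p => (h p)`_1); split=> [i|k p q|p q].
- by rewrite hx coefD coefC coefMX coefC add0r.
- by rewrite hZD coefD coefCM mulr_algl.
- by rewrite hM coefM big_ord_recl big_ord1 /= !h0; apply: mulr_leibniz.
Qed.

Definition deriv_ext : P -> P := sval (cid deriv_exists).

Lemma deriv_ext_var i : deriv_ext (x_ i) = f i.
Proof. by rewrite /deriv_ext; case: cid => D []. Qed.

Lemma deriv_extZD k p q : deriv_ext (k *: p + q) = k *: deriv_ext p + deriv_ext q.
Proof. by rewrite /deriv_ext; case: cid => D []. Qed.

Lemma deriv_extM p q : deriv_ext (p * q) = deriv_ext p * q + deriv_ext q * p.
Proof. by rewrite /deriv_ext; case: cid => D []. Qed.

End PolynomialDerivations.

(** * Biderivations and Poisson brackets determined by generators *)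

Section Biderivations.
Variables (F : fieldType) (V : comAlgType F).
Implicit Types (P : V -> V -> V) (D : V -> V).

Lemma scaleE k (a : V) : k *: a = GRing.in_alg V k * a.
Proof. by rewrite mulr_algl. Qed.

Definition is_derivation D : Prop :=
  (forall k a b, D (k *: a + b) = k *: D a + D b) /\
  (forall a b, D (a * b) = D a * b + D b * a).

Definition is_biderivation P : Prop :=
  (forall b, is_derivation (P^~ b)) /\ (forall a, is_derivation (P a)).

Section DerivationTheory.
Variables (D : V -> V) (D_der : is_derivation D).

Lemma der1 : D 1 = 0.
Proof.
have /eqP := D_der.2 1 1.
by rewrite !mulr1 -subr_eq0 opprD addNKr oppr_eq0 => /eqP.
Qed.

Lemma derD a b : D (a + b) = D a + D b.
Proof. by rewrite -[a in LHS]scale1r D_der.1 scale1r. Qed.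

Lemma der0 : D 0 = 0.
Proof. by apply: (addIr (D 0)); rewrite -derD !add0r. Qed.

Lemma derN a : D (- a) = - D a.
Proof. by apply: (addIr (D a)); rewrite -derD !addNr der0. Qed.

Lemma derA k : D (GRing.in_alg V k) = 0.
Proof. by rewrite -[GRing.in_alg V k]addr0 D_der.1 der0 der1 scaler0 addr0. Qed.

Lemma derAM k a : D (GRing.in_alg V k * a) = GRing.in_alg V k * D a.
Proof. by rewrite D_der.2 derA mul0r add0r mulrC. Qed.

End DerivationTheory.

Variables (X : Type) (x : X -> V).
Hypothesis x_ind : forall Q : V -> Prop,
  Q 1 -> (forall k p q, Q p -> Q q -> Q (k *: p + q)) ->
  (forall p q, Q p -> Q q -> Q (p * q)) -> (forall i, Q (x i)) ->
  forall p, Q p.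

Section Extension.
Hypothesis x_der : forall f : X -> V, exists D,
  is_derivation D /\ forall i, D (x i) = f i.

Lemma biderivation_exists (pi : X -> X -> V) : exists P,
  is_biderivation P /\ forall i j, P (x i) (x j) = pi i j.
Proof.
pose D f := sval (cid (x_der f)).
have D_der f : is_derivation (D f) by rewrite /D; case: cid => d [].
have D_x f i : D f (x i) = f i by rewrite /D; case: cid => d [].
(* For fixed [b], [D f b] is $V$-linear in [f], as one sees by induction on [b]. This gives the
   derivation rules in the first argument of the witness below, where that argument enters through
   [f]. *)
have D_comb f g g' c c' b : (forall i, f i = g i * c + g' i * c') ->
    D f b = D g b * c + D g' b * c'.
  move=> fE; elim/x_ind: b => [|k p q IHp IHq|p q IHp IHq|i].
  - by rewrite !der1 // !mul0r addr0.
  - by rewrite !(D_der _).1 IHp IHq !scaleE; ring.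
  - by rewrite !(D_der _).2 IHp IHq; ring.
  - by rewrite !D_x.
exists (fun a b => D (fun j => D (pi^~ j) a) b); split=> [|i j]; last by rewrite !D_x.
split=> [b|a]; last exact: D_der.
split=> [k a a'|a a'].
  rewrite /= [RHS](_ : _ = D (fun j => D (pi^~ j) a) b * GRing.in_alg V k +
    D (fun j => D (pi^~ j) a') b * 1); last by rewrite scaleE mulrC mulr1.
  by apply: D_comb => i; rewrite (D_der _).1 scaleE mulrC mulr1.
by rewrite /=; apply: D_comb => i; rewrite (D_der _).2.
Qed.

End Extension.

Section Poisson.
Variables (P : V -> V -> V) (P_bider : is_biderivation P).
Let Pl b := P_bider.1 b.
Let Pr a := P_bider.2 a.

Lemma bider_skew : (forall i j, P (x j) (x i) = - P (x i) (x j)) ->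
  forall a b, P b a = - P a b.
Proof.
move=> skew_x a b; elim/x_ind: a => [|k p q IHp IHq|p q IHp IHq|i].
- by rewrite (der1 (Pr b)) (der1 (Pl b)) oppr0.
- by rewrite (Pr b).1 (Pl b).1 IHp IHq scalerN opprD.
- by rewrite (Pr b).2 (Pl b).2 IHp IHq !mulNr opprD.
elim/x_ind: b => [|k p q IHp IHq|p q IHp IHq|j].
- by rewrite (der1 (Pr _)) (der1 (Pl _)) oppr0.
- by rewrite (Pr _).1 (Pl _).1 IHp IHq scalerN opprD.
- by rewrite (Pr _).2 (Pl _).2 IHp IHq !mulNr opprD.
exact: skew_x.
Qed.

Lemma bider_equivariant (f : {lrmorphism V -> V}) :
    (forall i j, P (f (x i)) (f (x j)) = f (P (x i) (x j))) ->
  forall a b, P (f a) (f b) = f (P a b).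
Proof.
move=> Pf_x a b; elim/x_ind: a => [|k p q IHp IHq|p q IHp IHq|i].
- by rewrite rmorph1 !(der1 (Pl _)) rmorph0.
- by rewrite linearP !(Pl _).1 IHp IHq linearP.
- by rewrite rmorphM !(Pl _).2 IHp IHq rmorphD !rmorphM.
elim/x_ind: b => [|k p q IHp IHq|p q IHp IHq|j].
- by rewrite rmorph1 !(der1 (Pr _)) rmorph0.
- by rewrite linearP !(Pr _).1 IHp IHq linearP.
- by rewrite rmorphM !(Pr _).2 IHp IHq rmorphD !rmorphM.
exact: Pf_x.
Qed.

Hypothesis P_skew : forall a b, P b a = - P a b.

Let jacobiator a b c := P a (P b c) + P b (P c a) + P c (P a b).

Let jacobiator_rot a b c : jacobiator a b c = jacobiator b c a.
Proof. by rewrite /jacobiator -addrA addrC. Qed.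

Let jacobiatorZD k a a' b c :
  jacobiator (k *: a + a') b c = k *: jacobiator a b c + jacobiator a' b c.
Proof.
rewrite /jacobiator ((Pr c).1 _ a) ((Pl b).1 _ a) (Pl _).1 !(Pr _).1 !scaleE.
ring.
Qed.

(** The terms that are products of two brackets cancel by skew-symmetry. *)
Let jacobiatorM a a' b c :
  jacobiator (a * a') b c = jacobiator a b c * a' + jacobiator a' b c * a.
Proof.
rewrite /jacobiator ((Pr c).2 a) ((Pl b).2 a) (Pl _).2 !(derD (Pr _)) !(Pr _).2.
rewrite (P_skew a b) (P_skew a' b) (P_skew a c) (P_skew a' c); ring.
Qed.

Let jacobiator1 b c : jacobiator 1 b c = 0.
Proof.
by rewrite /jacobiator !(der1 (Pl _)) (der1 (Pr _)) !(der0 (Pr _)) !addr0.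
Qed.

(** The jacobiator is a derivation in its first argument and is cyclically invariant, so the
    arguments are rotated into first place and reduced to generators one after the other. *)
Lemma bider_jacobi :
    (forall i j k, P (x i) (P (x j) (x k)) + P (x j) (P (x k) (x i)) +
                   P (x k) (P (x i) (x j)) = 0) ->
  forall a b c, P a (P b c) + P b (P c a) + P c (P a b) = 0.
Proof.
move=> jacobi_x.
have ind1 (b c : V) : (forall i, jacobiator (x i) b c = 0) ->
    forall a, jacobiator a b c = 0.
  move=> Jx a; elim/x_ind: a => [|k p q IHp IHq|p q IHp IHq|i].
  - exact: jacobiator1.
  - by rewrite jacobiatorZD IHp IHq scaler0 addr0.
  - by rewrite jacobiatorM IHp IHq !mul0r addr0.
  - exact: Jx.
move=> a b c; apply: (ind1 b c _ a) => {a} i.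
rewrite jacobiator_rot; apply: (ind1 c (x i) _ b) => {b} j.
rewrite jacobiator_rot; apply: (ind1 (x i) (x j) _ c) => {c} k.
by rewrite jacobiator_rot; apply: jacobi_x.
Qed.

End Poisson.
End Biderivations.

(** * Lambda-brackets from shift-invariant Poisson brackets *)

Section LambdaBrackets.
Variables (F : fieldType) (V : comAlgType F) (sh : int -> {lrmorphism V -> V}).
Hypotheses (sh0 : forall a, sh 0 a = a).
Hypothesis (shD : forall (m n : int) a, sh (m + n) a = sh m (sh n a)).

Lemma autz_shift n a : autz (sh 1) (sh (-1)) n a = sh n a.
Proof.
have iter_sh k m : iter m (sh k) a = sh (k *+ m) a.
  by elim: m => [|m IHm]; rewrite ?mulr0n ?sh0 // mulrS shD -IHm.
case: n => m; rewrite /autz iter_sh; last by rewrite NegzE mulNrn -natz.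
by congr (sh _ a); rewrite -natz.
Qed.

(** By invariance [sh n] maps [P (sh (m - n) a) b] to [P (sh m a) (sh n b)]; hence the coefficient
    of $\lambda^m\mu^n$ in the Jacobi identity is the Jacobi identity of [P] for [sh m a], [sh n b]
    and [c]. *)
Lemma poisson_mPVA (P : V -> V -> V) :
    is_biderivation P -> (forall a b, P b a = - P a b) ->
    (forall n a b, P (sh n a) (sh n b) = sh n (P a b)) ->
    (forall a b c, P a (P b c) + P b (P c a) + P c (P a b) = 0) ->
  is_mPVA (sh 1) (sh (-1)) (fun a b n => P (sh n a) b).
Proof.
move=> [Pl Pr] P_skew P_sh P_jac; split; first split.
- by move=> k a a' b n; rewrite linearP (Pl b).1.
- by move=> k a b b' n; rewrite (Pr _).1.
- by move=> a b n; rewrite shD.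
- by move=> a b n; rewrite -P_sh -shD addrCA subrr addr0.
- by move=> a b c n; rewrite (Pr _).2.
- by move=> a b c n; rewrite rmorphM (Pl c).2 !autz_shift.
- by move=> a b n; rewrite autz_shift -P_sh -shD subrr sh0 P_skew.
- move=> a b c m n; rewrite -P_sh -shD [n + _]addrC subrK.
  apply/eqP; rewrite -subr_eq0 [P (P _ _) c]P_skew opprK -(P_jac (sh m a) (sh n b) c).
  by rewrite -(derN (Pr _)) -P_skew.
Qed.

(** Serves for uniqueness: the shifts of the [x i] generate $V$, and sesquilinearity takes these
    shifts out of either argument. *)
Lemma lambda_bracket_ext (X : Type) (x : X -> V) :
    (forall Q : V -> Prop,
      Q 1 -> (forall k p q, Q p -> Q q -> Q (k *: p + q)) ->
      (forall p q, Q p -> Q q -> Q (p * q)) ->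
      (forall i n, Q (sh n (x i))) -> forall p, Q p) ->
  forall br br' : V -> V -> int -> V,
    is_lambda_bracket (sh 1) (sh (-1)) br ->
    is_lambda_bracket (sh 1) (sh (-1)) br' ->
    (forall i j n, br (x i) (x j) n = br' (x i) (x j) n) ->
  forall a b n, br a b n = br' a b n.
Proof.
move=> x_ind br br' br_lam br'_lam br_x.
have brl (B : V -> V -> int -> V) : is_lambda_bracket (sh 1) (sh (-1)) B ->
    forall k a b n, B (sh k a) b n = B a b (n + k).
  case=> _ _ Bs _ _ _ k a b n; elim/int_ind: k n => [|k IHk|k IHk] n.
  - by rewrite sh0 addr0.
  - by rewrite -addn1 PoszD addrC shD Bs IHk addrA.
  - rewrite -addn1 PoszD opprD [- _ + _]addrC shD.
    rewrite -[n in LHS](subrK 1 n) -Bs -shD subrr sh0 IHk.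
    by rewrite addrA.
have brr (B : V -> V -> int -> V) : is_lambda_bracket (sh 1) (sh (-1)) B ->
    forall k a b n, B a (sh k b) n = sh k (B a b (n - k)).
  case=> _ _ _ Bs _ _ k a b n; elim/int_ind: k n => [|k IHk|k IHk] n.
  - by rewrite subr0 !sh0.
  - by rewrite -addn1 PoszD addrC !shD Bs IHk opprD addrA.
  - rewrite -addn1 PoszD opprD [- _ + _]addrC !shD.
    rewrite -[LHS]sh0 -(addNr 1) shD -[n in LHS](addrK 1) -Bs -shD subrr sh0.
    by rewrite IHk opprD opprK addrA.
have der1l (B : V -> V -> int -> V) : is_lambda_bracket (sh 1) (sh (-1)) B ->
    (forall b n, B 1 b n = 0) /\ (forall a n, B a 1 n = 0).
  case=> _ _ _ _ Br Bl; split=> [b|a] n.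
    have /eqP := Bl 1 1 b n.
    by rewrite autz_shift rmorph1 !mulr1 -subr_eq0 opprD addNKr oppr_eq0 => /eqP.
  have /eqP := Br a 1 1 n.
  by rewrite !mulr1 -subr_eq0 opprD addNKr oppr_eq0 => /eqP.
move=> a; elim/x_ind: a => [b n|k p q IHp IHq b n|p q IHp IHq b n|i m b].
- by rewrite !(der1l _ _).1.
- by rewrite (bracket_linearl br_lam) (bracket_linearl br'_lam) IHp IHq.
- by rewrite (bracket_leibnizl br_lam) (bracket_leibnizl br'_lam) IHp IHq.
elim/x_ind: b => [n|k p q IHp IHq n|p q IHp IHq n|j l n].
- by rewrite !(der1l _ _).2.
- by rewrite (bracket_linearr br_lam) (bracket_linearr br'_lam) IHp IHq.
- by rewrite (bracket_leibnizr br_lam) (bracket_leibnizr br'_lam) IHp IHq.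
by rewrite !brl // !brr // br_x.
Qed.

End LambdaBrackets.

(** * Integer sign functions *)

Section IntegerSigns.
Variable N : nat.

(** Up to the factor $-1/2$ and a delta at 0, these are the coefficients of $((\lambda
    S)^N-1)^{-1}$. *)
Definition sgN (m : int) : int := if (N%:Z %| m)%Z then sgz m else 0.

Definition exch_coef (a b c d : int) : int := sgz (c - a) + sgz (d - b).

Definition diag_coef (a b c d : int) : int :=
  sgN (c - a) + sgN (d - b) - sgN (d - a) + (d == a)%:Z
  + sgN (b - c) - (b == c)%:Z.

Lemma sgN_opp (m : int) : sgN (- m) = - sgN m.
Proof. by rewrite /sgN rpredN sgzN; case: ifP => // _; rewrite oppr0. Qed.

(** Among the multiples of $N$, only 0 and $-N$ change sign when $N$ is added, each by one. *)
Lemma sgNDN (m : int) : (0 < N)%N ->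
  sgN (m + N) = sgN m + (m == 0)%:Z + (m == - N%:Z)%:Z.
Proof.
move=> N_gt0; rewrite /sgN rpredDr ?dvdzz //; case: ifPn => [/dvdzP[q ->]|Nm].
  have [q0|[q0|[q0|q0]]] : q = 0 \/ q = -1 \/ 0 < q \/ q <= -2 by lia.
  - by rewrite q0 mul0r add0r; lia.
  - by rewrite q0; lia.
  - by nia.
  - by nia.
have -> : (m == 0) = false by apply/eqP => m0; rewrite m0 dvdz0 in Nm.
have -> // : (m == - N%:Z) = false.
by apply/eqP => mN; rewrite mN rpredN dvdzz in Nm.
Qed.

(** A scalar form of the modified classical Yang-Baxter equation. The value is constant away from
    triple coincidence, which lets rows and columns cancel against each other in the Jacobi
    identity. *)
Lemma sgz_cyc (x y z : int) :
  sgz (y - x) * sgz (z - y) + sgz (z - y) * sgz (x - z) + sgz (x - z) * sgz (y - x) =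
  if (x == y) && (y == z) then 0 else -1.
Proof.
case: ifP; case: (sgzP (y - x)); case: (sgzP (z - y)); case: (sgzP (x - z)); lia.
Qed.

Lemma exch_coef_skew a b c d : exch_coef c d a b = - exch_coef a b c d.
Proof. by rewrite /exch_coef; lia. Qed.

Lemma diag_coef_skew a b c d : diag_coef c d a b = - diag_coef a b c d.
Proof.
rewrite /diag_coef -(opprB c a) -(opprB d b) !sgN_opp; ring.
Qed.

(** By [sgNDN] the signs at distance $N$ cancel in pairs and leave only deltas, to be compensated by
    the exchange term on the boundary. *)
Lemma diag_coef_unit (a c d : int) : (0 < N)%N ->
  diag_coef a (a + N) c d = (c == a)%:Z - (d == a + N%:Z)%:Z.
Proof.
move=> N_gt0.
have E x : sgN (a + N - x) = - sgN (x - a) + (x == a)%:Z + (x == a + N%:Z)%:Z.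
  by rewrite addrAC sgNDN // -(opprB x a) sgN_opp; move: (sgN _); lia.
rewrite /diag_coef -(opprB (a + N%:Z) d) sgN_opp !E.
move: (sgN (c - a)) (sgN (d - a)) => s t; lia.
Qed.

End IntegerSigns.

Section Halves.
Variable F : fieldType.

Definition half_int (k : int) : F := 2%:R^-1 * k%:~R.

Lemma halfN k : half_int (- k) = - half_int k.
Proof. by rewrite /half_int rmorphN mulrN. Qed.

Lemma halfD j k : half_int (j + k) = half_int j + half_int k.
Proof. by rewrite /half_int rmorphD mulrDr. Qed.

Lemma half0 : half_int 0 = 0.
Proof. by rewrite /half_int mulr0. Qed.

End Halves.

(** * The bracket of matrix entries and its Jacobi identity *)

Section AdlerBracket.
Variables (F : fieldType) (V : comAlgType F) (N : nat) (l : int -> int -> V).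
Local Notation half_int := (half_int F).
Local Notation sgN := (sgN N).
Local Notation diag_coef := (diag_coef N).
Hypothesis N_gt0 : (0 < N)%N.
Hypothesis l1 : forall a : int, l a (a + N) = 1.
Hypothesis l0 : forall a b : int, a + N%:Z < b -> l a b = 0.

(* [l a b] stands for the matrix entry at [(a, b)] of the difference operator
   [L]; the first summand is the quadratic Sklyanin bracket, in which the
   column indices are exchanged, and the second one is log-canonical. *)
Definition adler_table (a b c d : int) : V :=
  GRing.in_alg V (half_int (exch_coef a b c d)) * (l a d * l c b) +
  GRing.in_alg V (half_int (diag_coef a b c d)) * (l a b * l c d).

Lemma adler_table_skew a b c d : adler_table c d a b = - adler_table a b c d.
Proof.
rewrite /adler_table exch_coef_skew diag_coef_skew !halfN !rmorphN.
by ring.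
Qed.

(** The product [l a d * l c b] survives only if $d\le a+N$ and $b\le c+N$; then $d<b$ and $a<c$,
    and the two signs of [exch_coef] cancel. *)
Lemma adler_table0 (a b c d : int) : a + N%:Z < b -> adler_table a b c d = 0.
Proof.
move=> ab; rewrite /adler_table (l0 ab) !(mul0r, mulr0) addr0.
have [/l0->|da] := ltP (a + N%:Z) d; first by rewrite mul0r mulr0.
have [/l0->|bc] := ltP (c + N%:Z) b; first by rewrite !mulr0.
rewrite [exch_coef _ _ _ _](_ : _ = 0); last by rewrite /exch_coef; lia.
by rewrite half0 rmorph0 mul0r.
Qed.

(** The exchange product vanishes unless $d\le a+N$ and $c\ge a$. If both inequalities are strict,
    its two signs cancel; if $d=a+N$ or $c=a$, it equals the diagonal product, and the deltas of
    [diag_coef_unit] cancel the remaining sign. *)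
Lemma adler_table1 (a c d : int) : adler_table a (a + N) c d = 0.
Proof.
rewrite /adler_table diag_coef_unit // l1 mul1r.
have [d_gt|d_le] := ltP (a + N%:Z) d.
  rewrite (l0 d_gt) mul0r mulr0 add0r.
  have [d_gt'|d_le'] := ltP (c + N%:Z) d; first by rewrite l0 ?mulr0.
  rewrite [X in half_int X](_ : _ = 0); last lia.
  by rewrite half0 rmorph0 mul0r.
have [c_lt|c_ge] := ltP c a.
  rewrite (@l0 c); last lia.
  rewrite !mulr0 add0r.
  case: (eqVneq d (a + N%:Z)) => [->|dN].
    by rewrite l0 ?mulr0 //; lia.
  rewrite [X in half_int X](_ : _ = 0); last lia.
  by rewrite half0 rmorph0 mul0r.
case: (eqVneq d (a + N%:Z)) => [->|dN].
  rewrite l1 mul1r -mulrDl -rmorphD -halfD /exch_coef subrr.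
  rewrite [X in half_int X](_ : _ = 0) ?half0 ?rmorph0 ?mul0r //.
  by rewrite sgz0; lia.
case: (eqVneq c a) => [->|ca].
  rewrite l1 mulr1 -mulrDl -rmorphD -halfD /exch_coef subrr.
  rewrite [X in half_int X](_ : _ = 0) ?half0 ?rmorph0 ?mul0r //.
  by rewrite sgz0; lia.
rewrite [exch_coef _ _ _ _](_ : _ = 0); last by rewrite /exch_coef; lia.
by rewrite subrr half0 rmorph0 !mul0r addr0.
Qed.

(** Splitting the coefficients into functions of two indices gives [ring] atoms whose antisymmetry
    can be used by rewriting. *)
Let rho (a c : int) : V := GRing.in_alg V (half_int (sgz (c - a))).
Let alpha (a c : int) : V := GRing.in_alg V (half_int (sgN (c - a))).
Let beta (a d : int) : V := GRing.in_alg V (half_int (- sgN (d - a) + (d == a)%:Z)).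

Let exch_coefE a b c d :
  GRing.in_alg V (half_int (exch_coef a b c d)) = rho a c + rho b d.
Proof. by rewrite /exch_coef halfD rmorphD. Qed.

Let diag_coefE a b c d : GRing.in_alg V (half_int (diag_coef a b c d)) =
  alpha a c + alpha b d + beta a d - beta c b.
Proof.
rewrite /alpha /beta -!rmorphD -rmorphB -!halfD -halfN -halfD.
by congr (GRing.in_alg V (half_int _)); rewrite /diag_coef; ring.
Qed.

Let rhoN a c : rho c a = - rho a c.
Proof. by rewrite /rho -(opprB c a) sgzN halfN rmorphN. Qed.

Let alphaN a c : alpha c a = - alpha a c.
Proof. by rewrite /alpha -(opprB c a) sgN_opp halfN rmorphN. Qed.

Let rho_cyc x y z : rho x y * rho y z + rho y z * rho z x + rho z x * rho x y =
  if (x == y) && (y == z) then 0 else GRing.in_alg V (- (2%:R^-1 ^+ 2)).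
Proof.
rewrite /rho -!rmorphM -!rmorphD.
have -> : half_int (sgz (y - x)) * half_int (sgz (z - y)) +
    half_int (sgz (z - y)) * half_int (sgz (x - z)) +
    half_int (sgz (x - z)) * half_int (sgz (y - x)) =
    2%:R^-1 ^+ 2 * (sgz (y - x) * sgz (z - y) + sgz (z - y) * sgz (x - z) +
      sgz (x - z) * sgz (y - x))%:~R.
  by rewrite /half_int !rmorphD !rmorphM /=; ring.
rewrite sgz_cyc; case: ifP => _; rewrite ?mulr0 ?rmorph0 //.
by rewrite rmorphN mulrN mulr1.
Qed.

Variable P : V -> V -> V.
Hypothesis P_bider : is_biderivation P.
Hypothesis P_l : forall a b c d, P (l a b) (l c d) = adler_table a b c d.

Lemma adler_jacobi a1 b1 a2 b2 a3 b3 :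
  P (l a1 b1) (P (l a2 b2) (l a3 b3)) + P (l a2 b2) (P (l a3 b3) (l a1 b1)) +
  P (l a3 b3) (P (l a1 b1) (l a2 b2)) = 0.
Proof.
have Pr a := P_bider.2 a.
rewrite !P_l /adler_table !(derD (Pr _)) !(derAM (Pr _)) !(Pr _).2 !P_l.
rewrite /adler_table !exch_coefE !diag_coefE.
rewrite (rhoN a1 a2) (rhoN a2 a3) (rhoN a1 a3).
rewrite (rhoN b1 b2) (rhoN b2 b3) (rhoN b1 b3).
rewrite (alphaN a1 a2) (alphaN a2 a3) (alphaN a1 a3).
rewrite (alphaN b1 b2) (alphaN b2 b3) (alphaN b1 b3).
(* Every other monomial cancels by the antisymmetry of [rho] and [alpha] alone; the log-canonical
   part disappears with [beta] left arbitrary. *)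
rewrite [LHS](_ : _ =
  ((rho a1 a2 * rho a2 a3 + rho a2 a3 * - rho a1 a3 + - rho a1 a3 * rho a1 a2) -
   (rho b1 b2 * rho b2 b3 + rho b2 b3 * - rho b1 b3 + - rho b1 b3 * rho b1 b2)) *
  (l a1 b3 * l a2 b1 * l a3 b2 - l a1 b2 * l a2 b3 * l a3 b1)); last ring.
(* [rho_cyc] depends only on whether its three indices coincide; if the
   [a_i], or the [b_i], do coincide, then so do the two monomials. *)
rewrite -!rhoN !rho_cyc.
case: ifP => [/andP[/eqP-> /eqP->]|_]; first by ring.
case: ifP => [/andP[/eqP-> /eqP->]|_]; first by ring.
by rewrite subrr mul0r.
Qed.

End AdlerBracket.

(** The points of [r] may repeat and their values may be 0, so exponents that coincide accidentally
    need not be told apart. *)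
Lemma fsum_points (T : choiceType) (R : nmodType) (r : seq (T * R)) (f : T -> R) :
    (forall t, f t = \sum_(p <- r) if t == p.1 then p.2 else 0) ->
  \sum_(t \in [set: T]%classic) f t = \sum_(p <- r) p.2.
Proof.
move=> fE; rewrite (fsbigTE [fset t in map fst r]%fset) => [|t].
  under eq_bigr do rewrite fE.
  rewrite exchange_big; apply: eq_big_seq => p pr.
  rewrite (big_fsetD1 p.1) /=; last by rewrite in_fset map_f.
  rewrite eqxx big_seq big1 ?addr0 // => t.
  by rewrite in_fsetD1 => /andP[/negPf->].
rewrite in_fset => /= tr; rewrite fE big1_seq // => p /= pr.
by case: eqP tr => // -> /negP[]; rewrite map_f.
Qed.

Lemma fsum_point (T : choiceType) (R : nmodType) (t0 : T) (f : T -> R) :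
  (forall t, t != t0 -> f t = 0) -> \sum_(t \in [set: T]%classic) f t = f t0.
Proof.
move=> fE; rewrite (fsum_points (r := [:: (t0, f t0)])) ?big_seq1 // => t.
by rewrite big_seq1 /=; case: eqVneq => [->|/fE].
Qed.

(** * Coefficients of the Adler type identity *)

Section AdlerCoefficients.
Variables (F : fieldType) (V : comAlgType F) (sh : int -> {lrmorphism V -> V}).
Hypotheses (sh0 : forall a, sh 0 a = a).
Hypothesis (shD : forall (m n : int) a, sh (m + n) a = sh m (sh n a)).
Variables (N : nat) (L : int -> V).

Local Notation expo := (int * int * int * int)%type.
Local Notation "X *o Y" := (opmul (sh 1) (sh (-1)) expoS X Y) (at level 40).

(** In most products below the supports leave at most one possible term for each exponent; [d0]
    itself may contribute 0. *)
Lemma opmul_point (X Y : expo -> V) (e d0 : expo) :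
    (forall d, X d != 0 -> Y (e - d) != 0 -> d = d0) ->
  (X *o Y) e = X d0 * sh (expoS d0) (Y (e - d0)).
Proof.
move=> XY; rewrite /opmul (fsum_point (t0 := d0)) ?autz_shift // => d dd0.
rewrite autz_shift //; have [->|X0] := eqVneq (X d) 0; first by rewrite mul0r.
have [->|/(XY _ X0) E] := eqVneq (Y (e - d)) 0; first by rewrite rmorph0 mulr0.
by rewrite E eqxx in dd0.
Qed.

Lemma if0_neq0 (b : bool) (x : V) : (if b then x else 0) != 0 -> b.
Proof. by case: b; rewrite ?eqxx. Qed.

Lemma mul_if0 (b b' : bool) (x y : V) :
  (if b then x else 0) * (if b' then y else 0) = if b && b' then x * y else 0.
Proof. by case: b; case: b'; rewrite ?mul0r ?mulr0. Qed.

Lemma mulr_if0 (b : bool) (x y : V) :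
  x * (if b then y else 0) = if b then x * y else 0.
Proof. by case: b; rewrite ?mulr0. Qed.

Lemma sh_if0 n (b : bool) (x : V) :
  sh n (if b then x else 0) = if b then sh n x else 0.
Proof. by case: b; rewrite ?rmorph0. Qed.

Lemma shB n x y : sh n (x - y) = sh n x - sh n y.
Proof. exact: rmorphB. Qed.

Lemma sh_alg n k : sh n (GRing.in_alg V k) = GRing.in_alg V k.
Proof. by rewrite -[GRing.in_alg V k]/(k *: 1) linearZ rmorph1. Qed.

Lemma L_wlS_delta (i j l s : int) : (L_wlS L *o @delta_plus F V) (i, j, l, s) =
  if [&& l == j, s == j & i <= 0] then L (i + j) else 0.
Proof.
rewrite (@opmul_point _ _ _ (0, i + j, i + j, i + j)) => [|[[[a b] c] t]].
  rewrite /L_wlS /delta_plus /= sh_if0 rmorph1 mul_if0 mulr1.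
  by congr (if _ then _ else _); lia.
move=> /if0_neq0 /= h /if0_neq0 /= h'.
by congr (_, _, _, _); lia.
Qed.

Lemma L_wlS_delta_adjE (i j l s : int) :
  (L_wlS L *o @delta_plus F V *o Ladj_zl (sh 1) (sh (-1)) L) (i, j, l, s) =
  if s == j then (if i + l <= j then L (i + l) * sh l (L (j - l)) else 0) else 0.
Proof.
rewrite (@opmul_point _ _ _ (i + l - s, j, s, s)) => [|[[[a b] c] t]].
  rewrite L_wlS_delta /Ladj_zl /= sh_if0 autz_shift // -shD mul_if0.
  case: (eqVneq s j) => [->|_]; last by rewrite andbF.
  case: (lerP (i + l) j) => ij; last by rewrite ifF //; lia.
  rewrite ifT; last by lia.
  by congr (L _ * sh _ (L _)); lia.
rewrite L_wlS_delta => /if0_neq0 /= h /if0_neq0 /= h'.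
by congr (_, _, _, _); lia.
Qed.

Lemma L_z_delta (i j l s : int) : (L_z L *o @delta_plus F V) (i, j, l, s) =
  if [&& 0 <= j, l == j & s == j] then L (i + j) else 0.
Proof.
rewrite (@opmul_point _ _ _ (i + j, 0, 0, 0)) => [|[[[a b] c] t]].
  rewrite /L_z /delta_plus /= sh_if0 rmorph1 mulr_if0 mulr1.
  by congr (if _ then _ else _); lia.
move=> /if0_neq0 /= h /if0_neq0 /= h'.
by congr (_, _, _, _); lia.
Qed.

Lemma L_z_delta_wE (i j l s : int) :
  (L_z L *o @delta_plus F V *o L_w L) (i, j, l, s) =
  if s == l then (if 0 <= l then L (i + l) * sh l (L (j - l)) else 0) else 0.
Proof.
rewrite (@opmul_point _ _ _ (i, l, l, s)) => [|[[[a b] c] t]].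
  rewrite L_z_delta /L_w /= sh_if0 mul_if0.
  case: (eqVneq s l) => [->|_]; last by rewrite !andbF.
  by case: (lerP 0 l) => // l0; rewrite ifT //; lia.
rewrite L_z_delta => /if0_neq0 /= h /if0_neq0 /= h'.
by congr (_, _, _, _); lia.
Qed.

(** The exponent 0 belongs to the first of the two geometric expansions, hence the delta. *)
Let geom_coef (m : int) : F := half_int F (- (sgN N m + (m == 0)%:Z)).

Lemma lS_geomE (i j l s : int) : lS_geom V N (i, j, l, s) =
  if [&& i == 0, j == 0 & l == s] then GRing.in_alg V (geom_coef s) else 0.
Proof.
rewrite /lS_geom /geom_coef /sgN /half_int.
case: eqP => //= _; case: eqP => //= _; case: eqP => //= _.
case: ifPn => Ns; last first.
  have -> : (s == 0) = false by apply: contraNF Ns => /eqP->; rewrite dvdz0.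
  by rewrite addr0 oppr0 mulr0 scale0r.
have -> : - (sgz s + (s == 0)%:Z) = if 0 <= s then -1 else 1 by case: ifP; lia.
by case: ifP => _; rewrite ?mulrN1 ?mulr1 ?scalerN ?scaleNr.
Qed.

Lemma L_w_lS (i j l s : int) : (L_w L *o @lS_pow F V N) (i, j, l, s) =
  if [&& i == 0, l == N & s == N] then L j else 0.
Proof.
rewrite (@opmul_point _ _ _ (0, j, 0, 0)) => [|[[[a b] c] t]].
  rewrite /L_w /lS_pow /= sh_if0 rmorph1 mulr_if0 mulr1.
  by congr (if _ then _ else _); lia.
move=> /if0_neq0 /= h /if0_neq0 /= h'.
by congr (_, _, _, _); lia.
Qed.

Lemma geom_prod (i j l s : int) :
  ((L_w L *o @lS_pow F V N \- L_wlS L) *o lS_geom V N) (i, j, l, s) =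
  if [&& i == 0 & l == s]
  then L j * GRing.in_alg V (geom_coef (s - N%:Z) - geom_coef (s - j)) else 0.
Proof.
(* One point comes from $L(w)(\lambda S)^N$ and one from $L(w\lambda S)$; they coincide for
   $j=N$. *)
rewrite /opmul (fsum_points (r :=
  [:: ((0, j, N%:Z, N%:Z) : expo, if (i == 0) && (l == s) then
         L j * GRing.in_alg V (geom_coef (s - N%:Z)) else 0);
      ((0, j, j, j) : expo, if (i == 0) && (l == s) then
         - (L j * GRing.in_alg V (geom_coef (s - j))) else 0)])).
  by rewrite rmorphB mulrBr big_cons big_seq1 /=; case: ifP => _; rewrite ?addr0.
move=> [[[a b] c] t].
rewrite big_cons big_seq1 autz_shift //.
rewrite [X in X * _](_ : _ = (if [&& a == 0, c == N & t == N] then L b else 0) -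
  (if [&& a == 0, c == b & t == b] then L b else 0)); last by rewrite -L_w_lS.
rewrite -[_ - (a, b, c, t)]/(i - a, j - b, l - c, s - t) lS_geomE.
rewrite sh_if0 sh_alg mulrBl !mul_if0; cbn [fst snd]; rewrite !xpair_eqE.
congr (_ + _).
  case: ifP => h; case: ifP => h' //; try (case: ifP => h'' //); try (exfalso; lia).
  by have [-> ->] : b = j /\ t = N by lia.
case: ifP => h; case: ifP => h'; try (case: ifP => h'');
  rewrite ?oppr0 //; try (exfalso; lia).
by have [-> ->] : b = j /\ t = j by lia.
Qed.

Lemma L_z_sub_adj (i j l s : int) :
  (L_z L \- Ladj_zl (sh 1) (sh (-1)) L) (i, j, l, s) =
  if (j == 0) && (s == 0) then
    (if l == 0 then L i else 0) - (if l == - i then sh (- i) (L i) else 0)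
  else 0.
Proof.
rewrite /L_z /Ladj_zl /= autz_shift //.
by case: (j == 0); case: (s == 0); rewrite ?andbF ?andbT ?subrr.
Qed.

Lemma geom_sub_adjE (i j l s : int) :
  ((L_w L *o @lS_pow F V N \- L_wlS L) *o lS_geom V N *o
     (L_z L \- Ladj_zl (sh 1) (sh (-1)) L)) (i, j, l, s) =
  (if s == l then
     L j * GRing.in_alg V (geom_coef (l - N%:Z) - geom_coef (l - j)) * sh l (L i)
   else 0) +
  (if s == l + i then
     - (L j * GRing.in_alg V (geom_coef (l + i - N%:Z) - geom_coef (l + i - j))
       * sh l (L i))
   else 0).
Proof.
rewrite (@opmul_point _ _ _ (0, j, s, s)) => [|[[[a b] c] t]].
  rewrite geom_prod -[_ - (0, j, s, s)]/(i - 0, j - j, l - s, s - s) L_z_sub_adj.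
  rewrite !subrr !eqxx !andTb !subr0 shB !sh_if0 -shD mulrBr !mulr_if0.
  rewrite subr_eq0 [l == s]eq_sym; congr (_ + _); first by case: eqP => [->|].
  case: ifP => h; case: ifP => h' //; try (exfalso; lia); rewrite ?oppr0 //.
  by have [-> ->] : s = l + i /\ l + i + - i = l by lia.
rewrite geom_prod -[_ - (a, b, c, t)]/(i - a, j - b, l - c, s - t) L_z_sub_adj.
by move=> /if0_neq0 h /if0_neq0 h'; congr (_, _, _, _); lia.
Qed.

Hypothesis two_neq0 : 2%:R != 0 :> F.
Hypothesis N_gt0 : (0 < N)%N.

(** The entries at $(n,n+i)$ and $(0,j)$ are $S^n(u_i)$ and $u_j$, so this identifies the right-hand
    side of the theorem with the bracket table. *)
Lemma adlerDE (i j n : int) : adlerD (sh 1) (sh (-1)) N L i j n =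
  adler_table N (fun a b => sh a (L (b - a))) n (n + i) 0 j.
Proof.
pose X := L (i + n) * sh n (L (j - n)); pose Y := L j * sh n (L i).
pose g k := GRing.in_alg V (geom_coef (k - N%:Z) - geom_coef (k - j)).
(* The exponents of $S$: $j$ and $n$ from the two $\delta_+$ terms, then $n$ and $n+i$ from the
   geometric term applied to $L(z)$ and to $L^*(z^{-1}\lambda)$. *)
rewrite /adlerD (fsum_points (r :=
  [:: (j, if i + n <= j then X else 0); (n, - if 0 <= n then X else 0);
      (n, L j * g n * sh n (L i));
      (n + i, - (L j * g (n + i) * sh n (L i)))])); last first.
  move=> s; rewrite /adlerD_op /= L_wlS_delta_adjE L_z_delta_wE geom_sub_adjE.
  rewrite !big_cons big_nil addr0 /= !addrA -/X -/(g n) -/(g (n + i)).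
  by congr (_ + _ + _ + _); case: ifP; rewrite ?oppr0.
rewrite !big_cons big_nil addr0; cbn [fst snd].
(* For $n=0$ or $n+i=j$ the monomials [X] and [Y] are equal. Moving these deltas between the
   exchange and the diagonal part turns the step functions of $\delta_+$ into signs. *)
pose d0 : V := GRing.in_alg V (half_int F (n == 0)%:Z).
pose d1 : V := GRing.in_alg V (half_int F (n + i == j)%:Z).
have d0E : d0 * X = d0 * Y.
  rewrite /d0; case: eqVneq => [n0|_]; last by rewrite half0 rmorph0 !mul0r.
  by rewrite /X /Y n0 addr0 subr0 !sh0 [L i * _]mulrC.
have d1E : d1 * X = d1 * Y.
  rewrite /d1 /X /Y; case: eqVneq => [<-|_]; last by rewrite half0 rmorph0 !mul0r.
  by rewrite [i + n]addrC [n + i - n]addrAC subrr add0r.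
have half2 k : half_int F (k *+ 2) = k%:~R.
  by rewrite /half_int rmorphMn mulrnAr -mulrnAl -mulr_natl mulfV // mul1r.
have exchE : GRing.in_alg V (half_int F (exch_coef n (n + i) 0 j)) * X =
    (if i + n <= j then X else 0) - (if 0 <= n then X else 0) - d1 * X + d0 * X.
  pose b := (i + n <= j)%R; pose c := (0 <= n)%R.
  have ifE (e : bool) : (if e then X else 0) = GRing.in_alg V e%:Z%:~R * X.
    by case: e; rewrite /= ?scale1r ?scale0r ?mul1r ?mul0r.
  have -> : (if i + n <= j then X else 0) - (if 0 <= n then X else 0) =
      GRing.in_alg V (half_int F ((b%:Z - c%:Z) *+ 2)) * X.
    by rewrite half2 !ifE -mulrBl -!rmorphB.
  rewrite -mulrBl -mulrDl -rmorphB -rmorphD -halfN -!halfD.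
  by congr (GRing.in_alg V (half_int F _) * _); rewrite /exch_coef /b /c; lia.
have diagE : GRing.in_alg V (half_int F (diag_coef N n (n + i) 0 j)) =
    g n - g (n + i) - d0 + d1.
  rewrite -rmorphB -rmorphB -rmorphD /geom_coef -!halfN -!halfD.
  rewrite -!halfN -!halfD.
  congr (GRing.in_alg V (half_int F _)).
  have E m : sgN N (m - N%:Z) = sgN N m - (m == N%:Z)%:Z - (m == 0)%:Z.
    have := sgNDN (m - N%:Z) N_gt0; rewrite subrK => ->.
    by move: (sgN N _); lia.
  rewrite /diag_coef !E.
  rewrite -(opprB n 0) -(opprB (n + i) j) -(opprB n j) !sgN_opp !subr0.
  by move: (sgN N n) (sgN N (n + i)) (sgN N (n - j)) (sgN N (n + i - j)); lia.
rewrite /adler_table !sh0 !subr0 [n + i - n]addrAC subrr add0r.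
rewrite [sh n (L (j - n)) * _]mulrC [n + i]addrC -/X [sh n (L i) * _]mulrC -/Y.
rewrite [i + n]addrC exchE diagE d0E d1E [n + i]addrC /Y.
rewrite -!addrA; congr (_ + (_ + _)); rewrite !addrA; ring.
Qed.

End AdlerCoefficients.

(** * Rationality of symbols *)

Section Rationality.
Variables (V : idomainType) (sh : int -> {rmorphism V -> V}) (N : nat).
Hypotheses (sh0 : forall a, sh 0 a = a).
Hypothesis shD : forall (m n : int) a, sh (m + n) a = sh m (sh n a).
Hypothesis N_gt0 : (0 < N)%N.

Local Notation K := {fraction V}.
Local Notation "x %:F" := (@FracField.tofrac V x).
Local Notation opmulK :=
  (opmul (frac_lift (sh 1)) (frac_lift (sh (-1))) (@id int)).

Lemma shift_inj k : injective (sh k).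
Proof. by apply: (can_inj (g := sh (- k))) => a; rewrite -shD addNr sh0. Qed.

Lemma frac_lift_shift k (a : V) : frac_lift (sh k) a%:F = (sh k a)%:F.
Proof.
rewrite -[a%:F]divr1 -tofrac1 frac_liftE ?oner_eq0 //; last exact: shift_inj.
by rewrite rmorph1 tofrac1 divr1.
Qed.

Lemma autz_frac_lift n (a : V) :
  autz (frac_lift (sh 1)) (frac_lift (sh (-1))) n a%:F = (sh n a)%:F.
Proof.
have iter_sh k m : iter m (frac_lift (sh k)) a%:F = (sh (k *+ m) a)%:F.
  by elim: m => [|m IHm]; rewrite ?mulr0n ?sh0 // mulrS shD -frac_lift_shift -IHm.
case: n => m; rewrite /autz iter_sh; last by rewrite NegzE mulNrn -natz.
by congr ((sh _ a)%:F); rewrite -natz.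
Qed.

Lemma common_denominator n (v : 'I_n -> K) :
  exists (d : V) (w : 'I_n -> V), d != 0 /\ forall k, d%:F * v k = (w k)%:F.
Proof.
pose num k := \n_(repr (v k)); pose den k := \d_(repr (v k)).
have den0 k : den k != 0 by apply: denom_ratioP.
exists (\prod_k den k), (fun k => num k * \prod_(j | j != k) den j).
split=> [|k]; first by apply/prodf_neq0 => k _.
rewrite (bigD1 k) //= [v k]fracE -/(num k) -/(den k) !tofracM.
by rewrite mulrAC [_%:F * (_ / _)]mulrC divfK // tofrac_eq0.
Qed.

(** The kernel over the fraction field is nonzero by the rank bound, and clearing denominators
    brings a kernel vector into $V$. *)
Lemma underdetermined_system r (M : 'I_r -> 'I_r.+1 -> V) :
  exists2 w : 'I_r.+1 -> V, (exists k, w k != 0) &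
    forall t, \sum_k M t k * w k = 0.
Proof.
pose MK : 'M[K]_(r.+1, r) := \matrix_(k, t) (M t k)%:F.
have /rowV0Pn[v /sub_kermxP vM v0] : kermx MK != 0.
  rewrite kermx_eq0 /row_free neq_ltn.
  by rewrite (leq_ltn_trans (rank_leq_col _)).
have [d [w [d0 dw]]] := common_denominator (fun k => v 0 k).
exists w => [|t].
  have /rV0Pn[k vk] := v0; exists k.
  by rewrite -tofrac_eq0 -dw mulf_neq0 ?tofrac_eq0.
apply/eqP; rewrite -tofrac_eq0 rmorph_sum /=; apply/eqP.
have /rowP/(_ t) := vM; rewrite !mxE => /(congr1 ( *%R d%:F)).
rewrite mulr0 mulr_sumr; apply: etrans; apply: eq_bigr => k _.
by rewrite mxE tofracM -dw mulrCA [_ * v 0 k]mulrC.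
Qed.

(* [rp] and [rm] play the roles of r^+ and r^-; their difference is the symbol
   of the bilateral series sum_t x_t (sum_k S^(m_t + k N)) h_t, the triple
   (x_t, h_t, m_t) being [t]. *)
Definition rational_seq (c : int -> V) : Prop :=
  exists (rp rm : int -> V) (s : seq (V * V * int)),
    [/\ bounded_below rp, bounded_above rm, forall n, c n *+ 2 = rp n + rm n
      & forall n, rm n - rp n =
          \sum_(t <- s) t.1.1 * sh n t.1.2 * (N%:Z %| n - t.2)%Z%:R].

Lemma rational_seq_ext c c' : (forall n, c n = c' n) -> rational_seq c ->
  rational_seq c'.
Proof. by move=> /funext ->. Qed.

Lemma bounded_aboveD (c c' : int -> V) : bounded_above c -> bounded_above c' ->
  bounded_above (fun n => c n + c' n).
Proof.
move=> [m cm] [m' cm']; exists (Num.max m m') => n.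
by rewrite gt_max => /andP[mn m'n]; rewrite cm ?cm' ?addr0.
Qed.

Lemma bounded_belowD (c c' : int -> V) : bounded_below c -> bounded_below c' ->
  bounded_below (fun n => c n + c' n).
Proof.
move=> [m cm] [m' cm']; exists (Num.min m m') => n.
by rewrite lt_min => /andP[mn m'n]; rewrite cm ?cm' ?addr0.
Qed.

Lemma rational_seqD c c' : rational_seq c -> rational_seq c' ->
  rational_seq (fun n => c n + c' n).
Proof.
move=> [rp [rm [s [rpb rmb cE sE]]]] [rp' [rm' [s' [rpb' rmb' cE' sE']]]].
exists (fun n => rp n + rp' n), (fun n => rm n + rm' n), (s ++ s'); split=> [||n|n].
- exact: bounded_belowD.
- exact: bounded_aboveD.
- by rewrite mulrnDl cE cE' addrACA.
- by rewrite big_cat /= -sE -sE' opprD addrACA.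
Qed.

Lemma rational_seqMl c g : rational_seq c -> rational_seq (fun n => g * c n).
Proof.
move=> [rp [rm [s [[m rpm] [m' rmm'] cE sE]]]].
exists (fun n => g * rp n), (fun n => g * rm n).
exists [seq (g * t.1.1, t.1.2, t.2) | t <- s]; split=> [||n|n].
- by exists m => n /rpm->; rewrite mulr0.
- by exists m' => n /rmm'->; rewrite mulr0.
- by rewrite -mulrnAr cE mulrDr.
- by rewrite -mulrBr sE mulr_sumr big_map; apply: eq_bigr => t _; rewrite !mulrA.
Qed.

(** On operators this is multiplication by [g] on the right, as [rational_seqMl] is multiplication
    on the left. *)
Lemma rational_seqM_shift c g : rational_seq c ->
  rational_seq (fun n => c n * sh n g).
Proof.
move=> [rp [rm [s [[m rpm] [m' rmm'] cE sE]]]].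
exists (fun n => rp n * sh n g), (fun n => rm n * sh n g).
exists [seq (t.1.1, t.1.2 * g, t.2) | t <- s]; split=> [||n|n].
- by exists m => n /rpm->; rewrite mul0r.
- by exists m' => n /rmm'->; rewrite mul0r.
- by rewrite -mulrnAl cE mulrDl.
- rewrite -mulrBl sE mulr_suml big_map; apply: eq_bigr => t _ /=.
  by rewrite rmorphM mulrA mulrAC.
Qed.

Lemma rational_seq_finite c : bounded_below c -> bounded_above c -> rational_seq c.
Proof.
by move=> ? ?; exists c, c, [::]; split=> // n; rewrite big_nil subrr.
Qed.

Lemma rational_seq_sgN m : rational_seq (fun n => (sgN N (n - m))%:~R).
Proof.
(* Up to a delta at $n=m$, the sequence is half the sum of a series supported on $n\ge m$ and one
   supported on $n<m$, whose difference is $-2$ times the full periodic series. *)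
apply: (@rational_seq_ext (fun n =>
  ((N%:Z %| n - m)%Z%:Z * (if m <= n then 1 else -1))%:~R + (- (n == m)%:Z)%:~R)).
  move=> n; rewrite -rmorphD /sgN; congr _%:~R.
  case: (boolP (N%:Z %| n - m)%Z) => [_|Nm] /=; first by case: ifP; lia.
  suff -> : (n == m) = false by rewrite mul0r.
  by apply: contraNF Nm => /eqP->; rewrite subrr dvdz0.
apply: rational_seqD; last first.
  by apply: rational_seq_finite; exists m => n mn; rewrite (_ : _ == _ = false) //; lia.
exists (fun n => if m <= n then (N%:Z %| n - m)%Z%:R *+ 2 else 0).
exists (fun n => if m <= n then 0 else - ((N%:Z %| n - m)%Z%:R *+ 2)).
exists [:: (- 2%:R, 1, m)]; split=> [||n|n].
- by exists m => n mn; rewrite ifF //; lia.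
- by exists m => n mn; rewrite ifT //; lia.
- case: ifP => _; first by rewrite mulr1 addr0 -pmulrn.
  by rewrite mulrN1 add0r rmorphN mulNrn.
- rewrite big_seq1 /= rmorph1 mulr1 mulNr mulr_natl.
  by case: ifP => _; rewrite ?sub0r ?subr0.
Qed.

Lemma rational_seq_diag a b c d :
  rational_seq (fun n => (diag_coef N (a + n) (b + n) c d)%:~R).
Proof.
have ext (f g : int -> int) : (forall n, f n = g n) ->
    rational_seq (fun n => (f n)%:~R) -> rational_seq (fun n => (g n)%:~R).
  by move=> /funext->.
have D (f g : int -> int) : rational_seq (fun n => (f n)%:~R) ->
    rational_seq (fun n => (g n)%:~R) -> rational_seq (fun n => (f n + g n)%:~R).
  move=> rf rg; apply: rational_seq_ext (rational_seqD rf rg) => n.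
  by rewrite rmorphD.
have opp (f : int -> int) : rational_seq (fun n => (f n)%:~R) ->
    rational_seq (fun n => (- f n)%:~R).
  move=> rf; apply: rational_seq_ext (rational_seqMl (-1) rf) => n.
  by rewrite mulN1r rmorphN.
have sg (m : int) (f : int -> int) : (forall n, f n = n - m) ->
    rational_seq (fun n => (sgN N (f n))%:~R).
  by move=> fE; apply: ext (rational_seq_sgN m) => n; rewrite fE.
have sg' (m : int) (f : int -> int) : (forall n, f n = m - n) ->
    rational_seq (fun n => (sgN N (f n))%:~R).
  move=> fE; apply: ext (opp _ (rational_seq_sgN m)) => n.
  by rewrite fE -sgN_opp opprB.
have delta (m : int) (f : int -> bool) : (forall n, f n = (n == m)) ->
    rational_seq (fun n => ((f n)%:Z)%:~R).
  move=> fE; apply: rational_seq_finite; exists m => n mn; rewrite fE;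
    by rewrite (_ : _ == _ = false) //; lia.
rewrite /diag_coef; apply: (D); last apply: (opp).
  apply: (D); last by apply: (sg (c - b)) => n; lia.
  apply: (D); last by apply: (delta (d - a)) => n; lia.
  apply: (D); last by apply: (opp); apply: (sg' (d - a)) => n; lia.
  by apply: (D); [apply: (sg' (c - a)) | apply: (sg' (d - b))] => n; lia.
by apply: (delta (c - b)) => n; lia.
Qed.

Lemma opmul_frac (c b : int -> V) (r : nat) :
    (forall q : int, (forall k : 'I_r, q != (N * k)%N) -> b q = 0) ->
  opmulK (fun n => (c n)%:F) (fun n => (b n)%:F) =
  (fun n => (\sum_(k < r) c (n - (N * k)%N%:Z) *
               sh (n - (N * k)%N%:Z) (b (N * k)%N))%:F).
Proof.
move=> bE; apply/funext => n; rewrite /opmul.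
rewrite (fsum_points (r := [seq (n - (N * k)%N%:Z,
   (c (n - (N * k)%N%:Z) * sh (n - (N * k)%N%:Z) (b (N * k)%N))%:F)
   | k : 'I_r <- enum 'I_r])).
  by rewrite big_map big_enum /= rmorph_sum.
move=> d; rewrite autz_frac_lift -tofracM big_map big_enum /=.
have [[k /eqP dk]|nk] := pselect (exists k : 'I_r, d == n - (N * k)%N%:Z).
  rewrite (bigD1 k) //= dk eqxx subKr big1 ?addr0 // => k' k'k.
  rewrite ifF //; apply: contraNF k'k => /eqP E; apply/eqP/val_inj => /=.
  apply/eqP; rewrite -(eqn_pmul2l N_gt0); apply/eqP; lia.
rewrite bE ?rmorph0 ?mulr0 ?tofrac0; last first.
  by move=> k; apply/negP => /eqP E; apply: nk; exists k; apply/eqP; lia.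
by rewrite big1 // => k _; case: eqP => // dk; case: nk; exists k; apply/eqP.
Qed.

Lemma rational_seq_symbol c : 2%:R != 0 :> V -> rational_seq c ->
  is_rational_symbol (sh 1) (sh (-1)) c.
Proof.
move=> two0 [rp [rm [s [[m rpm] [m' rmm'] cE sE]]]].
(* A right denominator with coefficients at 0, N, ..., r N is annihilated by
   [rm - rp] as soon as it solves [r] linear equations in [r + 1] unknowns. *)
pose r := size s; pose t0 : V * V * int := (0, 0, 0).
have [w [k0 wk0] wE] := underdetermined_system
  (fun (t : 'I_r) (k : 'I_r.+1) => sh (- (N * k)%N%:Z) (nth t0 s t).1.2).
(* Twisting the unknowns makes the equations independent of $n$: [sh (n - N * k)] takes [b (N * k)]
   to [sh n (w k)], and subtracting $Nk$ does not affect divisibility by $N$. *)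
pose b (q : int) : V := \sum_(k < r.+1) if q == (N * k)%N then sh q (w k) else 0.
have bE (k : 'I_r.+1) : b (N * k)%N = sh (N * k)%N (w k).
  rewrite /b (bigD1 k) //= eqxx big1 ?addr0 // => k' k'k.
  rewrite ifF //; apply: contraNF k'k => /eqP[/eqP].
  by rewrite eqn_pmul2l // => /eqP E; apply/eqP/val_inj.
have b0 (q : int) : (forall k : 'I_r.+1, q != (N * k)%N) -> b q = 0.
  by move=> qN; rewrite /b big1 // => k _; rewrite (negPf (qN k)).
pose conv (f : int -> V) n := \sum_(k < r.+1) f (n - (N * k)%N%:Z) *
               sh (n - (N * k)%N%:Z) (b (N * k)%N).
(* The common value is the numerator $A$: it is bounded below through [rp] and above through
   [rm]. *)
have conv_eq : conv rm = conv rp.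
  apply/funext => n; apply/eqP; rewrite -subr_eq0 /conv -sumrB.
  under eq_bigr => k _ do rewrite -mulrBl sE bE -shD subrK mulr_suml.
  rewrite exchange_big /= (big_nth t0) big_mkord big1 // => t _.
  have := congr1 (fun x => (nth t0 s t).1.1 *
    (N%:Z %| n - (nth t0 s t).2)%Z%:R * sh n x) (wE t).
  rewrite rmorph0 mulr0 rmorph_sum mulr_sumr; apply: etrans; apply: eq_bigr => k _.
  rewrite rmorphM -shD /=.
  have -> : (N%:Z %| n - (N * k)%N%:Z - (nth t0 s t).2)%Z =
      (N%:Z %| n - (nth t0 s t).2)%Z.
    by rewrite addrAC rpredBr // PoszM dvdz_mulr.
  by rewrite -!mulrA; congr (_ * _); rewrite mulrCA.
exists (fun n => (conv rp n)%:F), (fun n => (b n)%:F), (fun n => (rp n)%:F),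
  (fun n => (rm n)%:F); split.
- split; split.
  + exists (m' + (N * r)%N%:Z) => n nm; rewrite -conv_eq /conv big1 ?tofrac0 // => k _.
    rewrite rmm' ?mul0r //.
    have : (N * k <= N * r)%N by rewrite leq_mul2l -ltnS ltn_ord orbT.
    lia.
  + exists m => n nm; rewrite /conv big1 ?tofrac0 // => k _.
    by rewrite rpm ?mul0r //; lia.
  + exists (N * r)%N%:Z => n nm; rewrite b0 ?tofrac0 // => k.
    have : (N * k <= N * r)%N by rewrite leq_mul2l -ltnS ltn_ord orbT.
    by lia.
  + by exists 0 => n nm; rewrite b0 ?tofrac0 // => k; lia.
- exists (N * k0)%N; rewrite tofrac_eq0 bE.
  by rewrite -(rmorph0 (sh (N * k0)%N)) (inj_eq (@shift_inj _)).
- split; last exact: opmul_frac.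
  by exists m => n /rpm->; rewrite tofrac0.
- split; last by rewrite -conv_eq; exact: opmul_frac.
  by exists m' => n /rmm'->; rewrite tofrac0.
- move=> n; rewrite -tofracD -cE -[c n *+ 2]mulr_natr tofracM rmorph_nat mulfK //.
  by rewrite -(rmorph_nat (@FracField.tofrac V)) tofrac_eq0.
Qed.

End Rationality.

(** * Existence of the Poisson bracket on free entries *)

Section AdlerPoisson.
Variables (F : fieldType) (V : comAlgType F) (sh : int -> {lrmorphism V -> V}).
Variables (N : nat) (l : int -> int -> V).
Hypotheses (N_gt0 : (0 < N)%N) (sh0 : forall a, sh 0 a = a).
Hypothesis shD : forall (m n : int) a, sh (m + n) a = sh m (sh n a).
Hypothesis l1 : forall a : int, l a (a + N) = 1.
Hypothesis l0 : forall a b : int, a + N%:Z < b -> l a b = 0.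
Hypothesis sh_l : forall k a b, sh k (l a b) = l (a + k) (b + k).
Hypothesis l_ind : forall Q : V -> Prop,
  Q 1 -> (forall k p q, Q p -> Q q -> Q (k *: p + q)) ->
  (forall p q, Q p -> Q q -> Q (p * q)) ->
  (forall a b : int, b < a + N%:Z -> Q (l a b)) -> forall p, Q p.
Hypothesis l_der : forall f : int -> int -> V, exists D,
  is_derivation D /\ forall a b : int, b < a + N%:Z -> D (l a b) = f a b.

Lemma sh_adler_table k a b c d : sh k (adler_table N l a b c d) =
  adler_table N l (a + k) (b + k) (c + k) (d + k).
Proof.
have E (x y : int) : x + k - (y + k) = x - y by lia.
rewrite /adler_table -!scaleE linearD !linearZ /= !rmorphM /= !sh_l.
by congr (half_int F _ *: _ + half_int F _ *: _);
  rewrite /exch_coef /diag_coef ?(inj_eq (addIr k)) !E.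
Qed.

Lemma adler_poisson_exists : exists P : V -> V -> V,
  [/\ is_biderivation P,
      forall a b c d, P (l a b) (l c d) = adler_table N l a b c d,
      forall a b, P b a = - P a b,
      forall n a b, P (sh n a) (sh n b) = sh n (P a b)
    & forall a b c, P a (P b c) + P b (P c a) + P c (P a b) = 0].
Proof.
pose X := {p : int * int | p.2 < p.1 + N%:Z}.
pose x (p : X) := l (val p).1 (val p).2.
have x_ind (Q : V -> Prop) : Q 1 -> (forall k p q, Q p -> Q q -> Q (k *: p + q)) ->
    (forall p q, Q p -> Q q -> Q (p * q)) -> (forall i, Q (x i)) -> forall p, Q p.
  move=> Q1 QZ QM Qx; apply: l_ind => // a b ab.
  exact: (Qx (Sub (a, b) ab : X)).
have x_der (f : X -> V) : exists D, is_derivation D /\ forall i, D (x i) = f i.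
  have [D [D_der DE]] := l_der (fun a b => odflt 0 (omap f (insub (a, b)))).
  exists D; split=> // -[[a b] ab]; rewrite /x DE //.
  by rewrite insubT.
pose pi (p q : X) := adler_table N l (val p).1 (val p).2 (val q).1 (val q).2.
have [P [P_bider P_x]] := biderivation_exists x_ind x_der pi.
have P_skew : forall a b, P b a = - P a b.
  by apply: (bider_skew x_ind P_bider) => i j; rewrite !P_x; apply: adler_table_skew.
(* [P] was prescribed on the free entries only. On the entries 1 and 0 it vanishes as a
   biderivation, and so does the table. *)
have P_l a b c d : P (l a b) (l c d) = adler_table N l a b c d.
  have P1 y : P 1 y = 0 := der1 (P_bider.1 y).
  have P0 y : P 0 y = 0 := der0 (P_bider.1 y).
  have [ab|ab|ab] := ltrgtP b (a + N%:Z).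
  - have [cd|cd|cd] := ltrgtP d (c + N%:Z).
    + exact: (P_x (Sub (a, b) ab : X) (Sub (c, d) cd : X)).
    + by rewrite P_skew adler_table_skew (l0 cd) P0 adler_table0.
    + by rewrite P_skew adler_table_skew cd l1 P1 adler_table1.
  - by rewrite (l0 ab) P0 adler_table0.
  - by rewrite ab l1 P1 adler_table1.
exists P; split=> //.
- move=> n; apply: (bider_equivariant x_ind P_bider) => i j.
  by rewrite /x !sh_l !P_l sh_adler_table.
- apply: (bider_jacobi x_ind P_bider P_skew) => i j k.
  exact: (adler_jacobi P_bider P_l).
Qed.

End AdlerPoisson.

(** * Difference polynomials as functions of the matrix entries *)

Section DifferencePolynomialShifts.
Variables (F : fieldType) (N : nat).
Local Notation V := (diffpoly F N).

Lemma diffpoly_shift0 (p : V) : shift 0 p = p.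
Proof.
pose g : {lrmorphism V -> V} := shift 0.
apply: (@poly_ext F (dvar N) g idfun _ p) => -[i n].
by rewrite /= (shift_var F 0) /dvar_shift /= addr0.
Qed.

Lemma diffpoly_shiftD (m n : int) (p : V) : shift (m + n) p = shift m (shift n p).
Proof.
pose g : {lrmorphism V -> V} := shift (m + n).
pose h : {lrmorphism V -> V} := shift m \o shift n.
apply: (@poly_ext F (dvar N) g h _ p) => -[i k].
rewrite /= (shift_var F (m + n)) (shift_var F n) (shift_var F m).
by rewrite /dvar_shift /= -addrA [n + m]addrC.
Qed.

Definition generic_entry (a b : int) : V := shift a (genericL F N (b - a)).

Lemma generic_entry_var (x : dvar N) :
  pvar F x = generic_entry x.2 (x.2 + val x.1).
Proof.
case: x => i k; rewrite /generic_entry /= addrC addKr /genericL valK shift_var.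
by rewrite /dvar_shift /= add0r.
Qed.

Lemma generic_entry1 (a : int) : generic_entry a (a + N%:Z) = 1.
Proof.
rewrite /generic_entry addrC addKr /genericL insubN ?ltxx // eqxx.
exact: rmorph1.
Qed.

Lemma generic_entry0 (a b : int) : a + N%:Z < b -> generic_entry a b = 0.
Proof.
move=> ab; rewrite /generic_entry /genericL insubN; last by lia.
rewrite ifF; last by lia.
exact: rmorph0.
Qed.

Lemma shift_generic_entry (k a b : int) :
  shift k (generic_entry a b) = generic_entry (a + k) (b + k).
Proof.
by rewrite /generic_entry -diffpoly_shiftD [k + a]addrC opprD addrACA subrr addr0.
Qed.

Lemma generic_entry_ind (Q : V -> Prop) :
    Q 1 -> (forall k p q, Q p -> Q q -> Q (k *: p + q)) ->
    (forall p q, Q p -> Q q -> Q (p * q)) ->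
    (forall a b : int, b < a + N%:Z -> Q (generic_entry a b)) ->
  forall p, Q p.
Proof.
move=> Q1 QZ QM Qg; apply: malg_var_ind => // x.
rewrite generic_entry_var; apply: Qg.
by rewrite ltrD2l; apply: (valP x.1).
Qed.

Lemma generic_entry_der (f : int -> int -> V) : exists D : V -> V,
  is_derivation D /\
  forall a b : int, b < a + N%:Z -> D (generic_entry a b) = f a b.
Proof.
pose g (x : dvar N) := f x.2 (x.2 + val x.1).
exists (deriv_ext g); split; first by split; [exact: deriv_extZD | exact: deriv_extM].
move=> a b ab; have ba : b - a < N%:Z by lia.
have -> : generic_entry a b = pvar F ((Sub (b - a) ba, a) : dvar N).
  by rewrite generic_entry_var /= addrCA subrr addr0.
by rewrite deriv_ext_var /g /= addrCA subrr addr0.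
Qed.

End DifferencePolynomialShifts.

(** Puts the log-canonical summand into the shape of a sign multiplied on the left by a fixed
    element and on the right by a shifted one, for which rationality is stable. *)
Lemma adler_tableE (F : fieldType) (V : comAlgType F) N (l : int -> int -> V) a b c d :
  adler_table N l a b c d =
  GRing.in_alg V (half_int F (exch_coef a b c d)) * (l a d * l c b) +
  GRing.in_alg V 2%:R^-1 * l c d * ((diag_coef N a b c d)%:~R * l a b).
Proof. by rewrite /adler_table /half_int !rmorphM !rmorph_int; ring. Qed.

(** * Rationality of the bracket *)

Section Bracket.
Variables (F : fieldType) (N : nat).
Hypothesis N_gt0 : (0 < N)%N.
Local Notation V := (diffpoly F N).
Local Notation l := (generic_entry F N).

Let rsh (k : int) : {rmorphism V -> V} := shift k.

(** The exchange part is a difference operator, since [l (a + n) d] vanishes for small $n$ and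
    [l c (b + n)] for large $n$; only the log-canonical part is non-local. *)
Lemma rational_seq_table (a b c d : int) :
  rational_seq rsh N (fun n => adler_table N l (a + n) (b + n) c d).
Proof.
have exch_rat : rational_seq rsh N (fun n =>
    GRing.in_alg V (half_int F (exch_coef (a + n) (b + n) c d)) *
    (l (a + n) d * l c (b + n))).
  apply: rational_seq_finite.
    exists (d - a - N%:Z) => n nd; rewrite (_ : l (a + n) d = 0) ?mul0r ?mulr0 //.
    by apply: generic_entry0; lia.
  exists (c + N%:Z - b) => n nc; rewrite (_ : l c (b + n) = 0) ?mulr0 //.
  by apply: generic_entry0; lia.
have diag_rat := rational_seqMl (GRing.in_alg V 2%:R^-1 * l c d)
  (rational_seqM_shift (l a b) (rational_seq_diag rsh N_gt0 a b c d)).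
apply: rational_seq_ext (rational_seqD exch_rat diag_rat) => n.
by rewrite adler_tableE -(shift_generic_entry F N n a b).
Qed.

(** The Leibniz rule multiplies symbols on the right in the first argument and on the left in the
    second, so rationality passes from entries to all of $V$. *)
Lemma rational_seq_poisson (P : V -> V -> V) :
    is_biderivation P ->
    (forall a b c d, P (l a b) (l c d) = adler_table N l a b c d) ->
  forall a b, rational_seq rsh N (fun n => P (shift n a) b).
Proof.
move=> [Pl Pr] P_l a b.
have zero : rational_seq rsh N (fun n => 0) by apply: rational_seq_finite; exists 0.
elim/generic_entry_ind: a => [|k p q rp rq|p q rp rq|a' b' _].
- apply: rational_seq_ext zero => n; rewrite rmorph1.
  exact/esym/(der1 (Pl b)).
- apply: rational_seq_ext
    (rational_seqD (rational_seqMl (GRing.in_alg V k) rp) rq) => n.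
  by rewrite -scaleE linearP; exact/esym/(Pl b).1.
- apply: rational_seq_ext
    (rational_seqD (rational_seqM_shift q rp) (rational_seqM_shift p rq)) => n.
  by rewrite rmorphM; exact/esym/(Pl b).2.
elim/generic_entry_ind: b => [|k p q rp rq|p q rp rq|c d _].
- apply: rational_seq_ext zero => n.
  exact/esym/(der1 (Pr _)).
- apply: rational_seq_ext
    (rational_seqD (rational_seqMl (GRing.in_alg V k) rp) rq) => n.
  by rewrite -scaleE; exact/esym/(Pr _).1.
- apply: rational_seq_ext
    (rational_seqD (rational_seqMl q rp) (rational_seqMl p rq)) => n.
  by rewrite (Pr _).2 ![_ * P _ _]mulrC.
- apply: rational_seq_ext (rational_seq_table a' b' c d) => n.
  by rewrite shift_generic_entry P_l.
Qed.

End Bracket.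

(** * Existence, rationality and uniqueness of the structure *)

Theorem proposition9p3 (F : fieldType) (char0 : [pchar F] =i pred0)
    (N : nat) (N_gt0 : (0 < N)%N) :
  let V := diffpoly F N in
  let S : V -> V := shift 1 in
  let S' : V -> V := shift (-1) in
  let u : int -> V := genericL F N in
  let rhs : int -> int -> int -> V := adlerD S S' N u in
  exists br : V -> V -> int -> V,
    [/\ is_mPVA S S' br,
        is_rational_bracket S S' br,
        forall i j n : int, br (u i) (u j) n = rhs i j n
      & forall br' : V -> V -> int -> V,
          is_lambda_bracket S S' br' ->
          (forall i j n : int, i < N%:Z -> j < N%:Z ->
             br' (u i) (u j) n = rhs i j n) ->
          forall a b n, br' a b n = br a b n].
Proof.
move=> V S S' u rhs.
pose sh (k : int) : {lrmorphism V -> V} := shift k.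
pose rsh (k : int) : {rmorphism V -> V} := shift k.
have sh0 (a : V) : sh 0 a = a by exact: diffpoly_shift0.
have shD (m n : int) (a : V) : sh (m + n) a = sh m (sh n a).
  exact: diffpoly_shiftD.
have F2 : 2%:R != 0 :> F by rewrite (pcharf0P F).1.
have V2 : 2%:R != 0 :> V by rewrite -(rmorph_nat (GRing.in_alg V)) fmorph_eq0.
have [P [P_bider P_l P_skew P_sh P_jac]] := adler_poisson_exists (sh := sh) N_gt0
  (@generic_entry1 F N) (@generic_entry0 F N) (@shift_generic_entry F N)
  (@generic_entry_ind F N) (@generic_entry_der F N).
have mPVA : is_mPVA S S' (fun a b n => P (shift n a) b).
  exact: (poisson_mPVA sh0 shD P_bider P_skew P_sh P_jac).
(* This holds for all $i$ and $j$, since [P_l] covers the entries 1 and 0 as well; in particular the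
   coefficients with $i=N$ or $j=N$ give the zero bracket with $u_N=1$. *)
have br_u i j n : P (shift n (u i)) (u j) = rhs i j n.
  rewrite /rhs (adlerDE sh0 shD u F2 N_gt0).
  have -> : u j = generic_entry F N 0 j.
    by rewrite /generic_entry subr0 diffpoly_shift0.
  have -> : shift n (u i) = generic_entry F N n (n + i).
    by rewrite /generic_entry addrC addKr.
  exact: P_l.
exists (fun a b n => P (shift n a) b); split=> //.
  move=> a b; apply: (rational_seq_symbol (sh := rsh) sh0 shD N_gt0 V2).
  exact: rational_seq_poisson.
move=> br' br'_lam br'_u.
apply: (lambda_bracket_ext sh0 shD (x := fun i : {i : int | i < N%:Z} => u (val i))
  _ br'_lam (mPVA_bracket mPVA)).
  move=> Q Q1 QZ QM Qu; apply: malg_var_ind => // x.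
  by rewrite generic_entry_var /generic_entry addrC addKr; apply: Qu.
by move=> i j n; rewrite br_u br'_u ?(valP i) ?(valP j).
Qed.
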